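(* Let $\mathcal{C}$ be a ribbon Ab-category whose ground ring $K=\operatorname{End}_{\mathcal{C}}(\mathbb{1})$ is a field. (a) If $\mathcal{I}$ is an ideal of $\mathcal{C}$ and $\{\mathsf{t}_V\}_{V\in\mathcal{I}}$ is a trace on $\mathcal{I}$, then for every $V\in\mathcal{I}$ the map $\mathsf{t}_V$ is an ambidextrous trace on $V$. (b) Conversely, if $J$ is an object of $\mathcal{C}$ and $\mathsf{t}:\operatorname{End}_{\mathcal{C}}(J)\to K$ is an ambidextrous trace on $J$, then there is a unique trace $\{\mathsf{t}_V\}_{V\in\mathcal{I}_J}$ on $\mathcal{I}_J$ with $\mathsf{t}_J=\mathsf{t}$.
   Context: A ribbon category is a tensor (monoidal) category $\mathcal{C}$ with unit object $\mathbb{1}$, with a braiding $c_{V,W}:V\otimes W\to W\otimes V$, a duality $V\mapsto V^*$ with morphisms $b_V:\mathbb{1}\to V\otimes V^*$, $d_V:V^*\otimes V\to\mathbb{1}$ satisfying $(\operatorname{Id}_V\otimes d_V)(b_V\otimes\operatorname{Id}_V)=\operatorname{Id}_V$ and $(d_V\otimes\operatorname{Id}_{V^*})(\operatorname{Id}_{V^*}\otimes b_V)=\operatorname{Id}_{V^*}$, and a twist $\theta_V:V\to V$ (with the usual compatibility axioms). It is an Ab-category if all Hom sets are additive abelian groups and composition and tensor product of morphisms are bilinear. $K=\operatorname{End}_{\mathcal{C}}(\mathbb{1})$ is a commutative ring (assumed a field), and Hom sets are $K$-modules via $kf=k\otimes f$. No existence of direct sums is assumed. Put $b'_V=(\operatorname{Id}_{V^*}\otimes\theta_V)\circ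 c_{V,V^*}\circ b_V:\mathbb{1}\to V^*\otimes V$ and $d'_V=d_V\circ c_{V,V^*}\circ(\theta_V\otimes\operatorname{Id}_{V^*}):V\otimes V^*\to\mathbb{1}$. For $f\in\operatorname{End}_{\mathcal{C}}(V\otimes W)$ set $\operatorname{tr}_L(f)=(d_V\otimes\operatorname{Id}_W)\circ(\operatorname{Id}_{V^*}\otimes f)\circ(b'_V\otimes\operatorname{Id}_W)\in\operatorname{End}_{\mathcal{C}}(W)$ and $\operatorname{tr}_R(f)=(\operatorname{Id}_V\otimes d'_W)\circ(f\otimes\operatorname{Id}_{W^*})\circ(\operatorname{Id}_V\otimes b_W)\in\operatorname{End}_{\mathcal{C}}(V)$. An ideal of $\mathcal{C}$ is a full subcategory $\mathcal{I}$ such that (1) $V\in\mathcal{I}$, $W\in\mathcal{C}$ imply $V\otimes W\in\mathcal{I}$; (2) $\mathcal{I}$ is closed under retracts: if $V\in\mathcal{I}$, $f:W\to V$, $g:V\to W$ and $g\circ f=\operatorname{Id}_W$ then $W\in\mathcal{I}$. For an object $J$, $\mathcal{I}_J$ is the ideal of all objects $U$ for which there are an object $W$ and morphisms $\alpha:U\to J\otimes W$, $\beta:J\otimes W\to U$ with $\beta\circ\alpha=\operatorname{Id}_U$. A trace on an ideal $\mathcal{I}$ is a family of $K$-linear functions $\mathsf{t}_V:\operatorname{End}_{\mathcal{C}}(V)\to K$, $V\in\mathcal{I}$, such that (1) for $U\in\mathcal{I}$, $W\in\mathcal{C}$ and $f\in\operatorname{End}_{\mathcal{C}}(U\otimes W)$,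 $\mathsf{t}_{U\otimes W}(f)=\mathsf{t}_U(\operatorname{tr}_R(f))$; (2) for $U,V\in\mathcal{I}$, $f:V\to U$, $g:U\to V$, $\mathsf{t}_V(g\circ f)=\mathsf{t}_U(f\circ g)$. An ambidextrous trace on an object $V$ is a $K$-linear function $\mathsf{t}:\operatorname{End}_{\mathcal{C}}(V)\to K$ with $\mathsf{t}(\operatorname{tr}_L(f))=\mathsf{t}(\operatorname{tr}_R(f))$ for all $f\in\operatorname{End}_{\mathcal{C}}(V\otimes V)$. *)

(* Defs.v *)
From HB Require Import structures.
From mathcomp Require Import all_boot ssralg.

Set Implicit Arguments.
Unset Strict Implicit.
Unset Printing Implicit Defensive.

Import GRing.Theory.
Local Open Scope ring_scope.

Declare Scope cat_scope.
Delimit Scope cat_scope with cat.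
Local Open Scope cat_scope.

Reserved Notation "g ∘ f" (at level 40, left associativity).
Reserved Notation "V ⊗ W" (at level 38, left associativity).
Reserved Notation "f ⊠ g" (at level 38, left associativity).
Reserved Notation "V ^⋆" (at level 1, format "V ^⋆").

Record ab_category := AbCategory {
  object :> Type;
  Hom : object -> object -> zmodType;
  idm : forall V : object, Hom V V;
  compm : forall U V W : object, Hom V W -> Hom U V -> Hom U W;
  comp_idl : forall U V (f : Hom U V), compm (idm V) f = f;
  comp_idr : forall U V (f : Hom U V), compm f (idm U) = f;
  comp_assoc : forall U V W X (h : Hom W X) (g : Hom V W) (f : Hom U V),
    compm h (compm g f) = compm (compm h g) f;
  compDl : forall U V W (g h : Hom V W) (f : Hom U V),
    compm (g + h) f = compm g f + compm h f;
  compDr : forall U V W (g : Hom V W) (f h : Hom U V),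
    compm g (f + h) = compm g f + compm g h
}.

Arguments idm {a} V.
Notation "g ∘ f" := (compm g f) : cat_scope.

Definition inverse_pair (C : ab_category) (V W : C)
    (f : Hom V W) (g : Hom W V) : Prop :=
  g ∘ f = idm V /\ f ∘ g = idm W.

Definition is_iso (C : ab_category) (V W : C) (f : Hom V W) : Prop :=
  exists g : Hom W V, inverse_pair f g.

(* Strictness is not assumed: [assoc], [lunit], [runit] are the associativity
   and unit constraints, and [assoc_inv], [lunit_inv], [runit_inv] their
   inverses. *)
Record tensor_category := TensorCategory {
  ab_of_tensor :> ab_category;
  tensor : ab_of_tensor -> ab_of_tensor -> ab_of_tensor;
  tensor_hom : forall U U' V V' : ab_of_tensor,
    Hom U U' -> Hom V V' -> Hom (tensor U V) (tensor U' V');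
  unit_object : ab_of_tensor;
  assoc : forall U V W : ab_of_tensor,
    Hom (tensor (tensor U V) W) (tensor U (tensor V W));
  assoc_inv : forall U V W : ab_of_tensor,
    Hom (tensor U (tensor V W)) (tensor (tensor U V) W);
  lunit : forall V : ab_of_tensor, Hom (tensor unit_object V) V;
  lunit_inv : forall V : ab_of_tensor, Hom V (tensor unit_object V);
  runit : forall V : ab_of_tensor, Hom (tensor V unit_object) V;
  runit_inv : forall V : ab_of_tensor, Hom V (tensor V unit_object);
  tensor_id : forall U V : ab_of_tensor,
    tensor_hom (idm U) (idm V) = idm (tensor U V);
  tensor_comp : forall (U U' U'' V V' V'' : ab_of_tensor)
      (f' : Hom U' U'') (f : Hom U U') (g' : Hom V' V'') (g : Hom V V'),
    tensor_hom (f' ∘ f) (g' ∘ g) = tensor_hom f' g' ∘ tensor_hom f g;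
  tensorDl : forall (U U' V V' : ab_of_tensor)
      (f f' : Hom U U') (g : Hom V V'),
    tensor_hom (f + f') g = tensor_hom f g + tensor_hom f' g;
  tensorDr : forall (U U' V V' : ab_of_tensor)
      (f : Hom U U') (g g' : Hom V V'),
    tensor_hom f (g + g') = tensor_hom f g + tensor_hom f g';
  assoc_inverse : forall U V W, inverse_pair (assoc U V W) (assoc_inv U V W);
  lunit_inverse : forall V, inverse_pair (lunit V) (lunit_inv V);
  runit_inverse : forall V, inverse_pair (runit V) (runit_inv V);
  assoc_natural : forall (U U' V V' W W' : ab_of_tensor)
      (f : Hom U U') (g : Hom V V') (h : Hom W W'),
    assoc U' V' W' ∘ tensor_hom (tensor_hom f g) h
    = tensor_hom f (tensor_hom g h) ∘ assoc U V W;
  lunit_natural : forall (V V' : ab_of_tensor) (f : Hom V V'),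
    lunit V' ∘ tensor_hom (idm unit_object) f = f ∘ lunit V;
  runit_natural : forall (V V' : ab_of_tensor) (f : Hom V V'),
    runit V' ∘ tensor_hom f (idm unit_object) = f ∘ runit V;
  pentagon : forall U V W X : ab_of_tensor,
    tensor_hom (idm U) (assoc V W X) ∘ assoc U (tensor V W) X
      ∘ tensor_hom (assoc U V W) (idm X)
    = assoc U V (tensor W X) ∘ assoc (tensor U V) W X;
  triangle : forall U V : ab_of_tensor,
    tensor_hom (idm U) (lunit V) ∘ assoc U unit_object V
    = tensor_hom (runit U) (idm V)
}.

Arguments unit_object {t}.
Arguments assoc {t} U V W.
Arguments assoc_inv {t} U V W.
Arguments lunit {t} V.
Arguments lunit_inv {t} V.
Arguments runit {t} V.
Arguments runit_inv {t} V.
Notation "V ⊗ W" := (tensor V W) : cat_scope.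
Notation "f ⊠ g" := (tensor_hom f g) : cat_scope.
Notation "𝟙" := unit_object : cat_scope.

Record braided_category := BraidedCategory {
  tensor_of_braided :> tensor_category;
  braid : forall V W : tensor_of_braided, Hom (V ⊗ W) (W ⊗ V);
  braid_iso : forall V W, is_iso (braid V W);
  braid_natural : forall (V V' W W' : tensor_of_braided)
      (f : Hom V V') (g : Hom W W'),
    braid V' W' ∘ (f ⊠ g) = (g ⊠ f) ∘ braid V W;
  hexagon1 : forall U V W : tensor_of_braided,
    assoc V W U ∘ braid U (V ⊗ W) ∘ assoc U V W
    = (idm V ⊠ braid U W) ∘ assoc V U W ∘ (braid U V ⊠ idm W);
  hexagon2 : forall U V W : tensor_of_braided,
    assoc_inv W U V ∘ braid (U ⊗ V) W ∘ assoc_inv U V W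
    = (braid U W ⊠ idm V) ∘ assoc_inv U W V ∘ (idm U ⊠ braid V W)
}.

Arguments braid {b} V W.

Record ribbon_category := RibbonCategory {
  braided_of_ribbon :> braided_category;
  dual : braided_of_ribbon -> braided_of_ribbon;
  coev : forall V : braided_of_ribbon, Hom 𝟙 (V ⊗ dual V);
  ev : forall V : braided_of_ribbon, Hom (dual V ⊗ V) 𝟙;
  zigzag : forall V : braided_of_ribbon,
    runit V ∘ (idm V ⊠ ev V) ∘ assoc V (dual V) V
      ∘ (coev V ⊠ idm V) ∘ lunit_inv V
    = idm V;
  zigzag_dual : forall V : braided_of_ribbon,
    lunit (dual V) ∘ (ev V ⊠ idm (dual V)) ∘ assoc_inv (dual V) V (dual V)
      ∘ (idm (dual V) ⊠ coev V) ∘ runit_inv (dual V)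
    = idm (dual V);
  twist : forall V : braided_of_ribbon, Hom V V;
  twist_iso : forall V, is_iso (twist V);
  twist_natural : forall (V W : braided_of_ribbon) (f : Hom V W),
    twist W ∘ f = f ∘ twist V;
  twist_tensor : forall V W : braided_of_ribbon,
    twist (V ⊗ W) = braid W V ∘ braid V W ∘ (twist V ⊠ twist W);
  twist_dual : forall V : braided_of_ribbon,
    (twist V ⊠ idm (dual V)) ∘ coev V
    = (idm V ⊠ twist (dual V)) ∘ coev V
}.

Arguments coev {r} V.
Arguments ev {r} V.
Arguments twist {r} V.
Notation "V ^⋆" := (dual V) : cat_scope.

(* [ground C] and [endo V] are aliases of Hom groups that carry the ring
   structure of [K] and the [K]-module structure of [End V]. *)
Definition ground (C : tensor_category) : Type := @Hom C 𝟙 𝟙.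
Definition endo (C : tensor_category) (V : C) : Type := Hom V V.

Section GroundRing.
Variable C : tensor_category.

HB.instance Definition _ := GRing.Zmodule.on (ground C).

Definition ground_one : ground C := @idm C 𝟙.
Definition ground_mul (k l : ground C) : ground C := @compm C 𝟙 𝟙 𝟙 k l.

Fact ground_mulA : associative ground_mul.
Proof. by move=> k l m; apply: comp_assoc. Qed.

Fact ground_mul1l : left_id ground_one ground_mul.
Proof. by move=> k; apply: comp_idl. Qed.

Fact ground_mul1r : right_id ground_one ground_mul.
Proof. by move=> k; apply: comp_idr. Qed.

Fact ground_mulDl : left_distributive ground_mul +%R.
Proof. by move=> k l m; apply: compDl. Qed.

Fact ground_mulDr : right_distributive ground_mul +%R.
Proof. by move=> k l m; apply: compDr. Qed.

HB.instance Definition _ := GRing.Zmodule_isPzRing.Build (ground C)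
  ground_mulA ground_mul1l ground_mul1r ground_mulDl ground_mulDr.

End GroundRing.

Section EndModule.
Variables (C : tensor_category) (V : C).

HB.instance Definition _ := GRing.Zmodule.on (endo V).

(* [kf = k ⊗ f], with [𝟙 ⊗ V] identified with [V] by the unit constraint. *)
Definition endo_scale (k : ground C) (f : endo V) : endo V :=
  lunit V ∘ tensor_hom (k : Hom 𝟙 𝟙) (f : Hom V V) ∘ lunit_inv V.

Fact endo_scaleA (k l : ground C) (f : endo V) :
  endo_scale k (endo_scale l f) = endo_scale (k * l) f.
Proof.
have [lK _] := lunit_inverse V.
have id_tensor (g : Hom V V) : idm 𝟙 ⊠ g = lunit_inv V ∘ g ∘ lunit V.
  by rewrite -comp_assoc -lunit_natural comp_assoc lK comp_idl.
have tensorE (g : Hom V V) :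
    tensor_hom (k : Hom 𝟙 𝟙) g
    = ((k : Hom 𝟙 𝟙) ⊠ idm V) ∘ (lunit_inv V ∘ g ∘ lunit V).
  by rewrite -id_tensor -tensor_comp comp_idr comp_idl.
rewrite /endo_scale tensorE -!comp_assoc.
rewrite (comp_assoc (lunit_inv V) (lunit V)) lK comp_idl.
rewrite (comp_assoc (lunit_inv V) (lunit V)) lK comp_idl.
by rewrite (comp_assoc (tensor_hom _ _) (tensor_hom _ _)) -tensor_comp comp_idl.
Qed.

Fact endo_scale1 : left_id 1 endo_scale.
Proof.
move=> f; have [_ lK] := lunit_inverse V.
by rewrite /endo_scale lunit_natural -comp_assoc lK comp_idr.
Qed.

Fact endo_scaleDr : right_distributive endo_scale +%R.
Proof. by move=> k f g; rewrite /endo_scale tensorDr compDr compDl. Qed.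

Fact endo_scaleDl (f : endo V) : {morph endo_scale^~ f : k l / k + l}.
Proof. by move=> k l; rewrite /endo_scale tensorDl compDr compDl. Qed.

HB.instance Definition _ := GRing.Zmodule_isLmodule.Build (ground C) (endo V)
  endo_scaleA endo_scale1 endo_scaleDr endo_scaleDl.

End EndModule.

Definition is_field (R : pzRingType) : Prop :=
  [/\ (1 : R) != 0, commutative (@GRing.mul R)
    & forall x : R, x != 0 -> exists y : R, y * x = 1].

Section Traces.
Variable C : ribbon_category.
Implicit Types U V W J : C.

Definition coev' V : Hom 𝟙 (V^⋆ ⊗ V) :=
  (idm (V^⋆) ⊠ twist V) ∘ braid V (V^⋆) ∘ coev V.

Definition ev' V : Hom (V ⊗ V^⋆) 𝟙 :=
  ev V ∘ braid V (V^⋆) ∘ (twist V ⊠ idm (V^⋆)).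

Definition trL V W (f : endo (V ⊗ W)) : endo W :=
  lunit W ∘ (ev V ⊠ idm W) ∘ assoc_inv (V^⋆) V W
    ∘ tensor_hom (idm (V^⋆)) (f : Hom (V ⊗ W) (V ⊗ W))
    ∘ assoc (V^⋆) V W ∘ (coev' V ⊠ idm W) ∘ lunit_inv W.

Definition trR V W (f : endo (V ⊗ W)) : endo V :=
  runit V ∘ (idm V ⊠ ev' W) ∘ assoc V W (W^⋆)
    ∘ tensor_hom (f : Hom (V ⊗ W) (V ⊗ W)) (idm (W^⋆))
    ∘ assoc_inv V W (W^⋆) ∘ (idm V ⊠ coev W) ∘ runit_inv V.

Record ideal := Ideal {
  in_ideal :> C -> Prop;
  ideal_tensor : forall V W, in_ideal V -> in_ideal (V ⊗ W);
  ideal_retract : forall V W (f : Hom W V) (g : Hom V W),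
    in_ideal V -> g ∘ f = idm W -> in_ideal W
}.

Definition generated_by J U : Prop :=
  exists W (α : Hom U (J ⊗ W)) (β : Hom (J ⊗ W) U), β ∘ α = idm U.

Fact generated_tensor J V W : generated_by J V -> generated_by J (V ⊗ W).
Proof.
move=> [X [α [β βα]]]; have [aK _] := assoc_inverse J X W.
exists (X ⊗ W), (assoc J X W ∘ (α ⊠ idm W)), ((β ⊠ idm W) ∘ assoc_inv J X W).
rewrite comp_assoc -(comp_assoc (β ⊠ _)) aK comp_idr -tensor_comp βα.
by rewrite comp_idl tensor_id.
Qed.

Fact generated_retract J V W (f : Hom W V) (g : Hom V W) :
  generated_by J V -> g ∘ f = idm W -> generated_by J W.
Proof.
move=> [X [α [β βα]]] gf; exists X, (α ∘ f), (g ∘ β).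
by rewrite comp_assoc -(comp_assoc g) βα comp_idr.
Qed.

Definition ideal_of J : ideal :=
  Ideal (@generated_tensor J) (@generated_retract J).

Fact ideal_of_self J : ideal_of J J.
Proof.
by exists 𝟙, (runit_inv J), (runit J); have [] := runit_inverse J.
Qed.

(* The regular module [(ground C)^o] is [K] as a module over itself. *)
Definition functional V : Type := endo V -> (ground C)^o.

Definition trace_family (I : ideal) : Type := forall V, I V -> functional V.

Definition is_trace (I : ideal) (t : trace_family I) : Prop :=
  [/\ forall V (IV : I V), linear (t V IV),
      forall U W (IU : I U) (f : endo (U ⊗ W)),
        t (U ⊗ W) (ideal_tensor W IU) f = t U IU (trR f)
    & forall U V (IU : I U) (IV : I V) (f : Hom V U) (g : Hom U V),
        t V IV (g ∘ f) = t U IU (f ∘ g)].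

Definition ambidextrous V (t : functional V) : Prop :=
  linear t /\ forall f : endo (V ⊗ V), t (trL f) = t (trR f).

End Traces.

Arguments is_trace {C} I t.

(* Main.v *)
(** Let [F : J ⊗ W -> J ⊗ W'] and [G : J ⊗ W' -> J ⊗ W].  Joining [F] and [G] by
    their strands [W] and [W'], but leaving their strands [J] open and crossing
    them once, gives an endomorphism [h] of [J ⊗ J].  Closing one strand of [h]
    yields [tr_R (F G)], closing the other one yields [tr_R (G F)], up to a twist
    produced by the resulting kink.  So an ambidextrous [t] satisfies
    [t (tr_R (F G)) = t (tr_R (G F))].  Applied to retracts [(α, β)] of [J ⊗ W],
    this shows at once that [f |-> t (tr_R (α f β))] does not depend on the
    retract and that it is cyclic.  In the other direction, [tr_L f] is [tr_R] of
    the conjugate of [f] by the braiding, and a trace is invariant under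
    conjugation.

    Associativity constraints are kept out of the diagrams by letting every
    morphism act on the left of an arbitrary tail [X]: all objects then have the
    form [V1 ⊗ (V2 ⊗ (... ⊗ X))], and no unit or associator occurs between
    generators. *)
Require Import Defs.
From mathcomp Require Import all_boot ssralg boolp.
Set Implicit Arguments.
Unset Strict Implicit.
Unset Printing Implicit Defensive.
Import GRing.Theory.
Local Open Scope ring_scope.
Local Open Scope cat_scope.

Notation "V ◁ f" := (tensor_hom (idm V) f) (at level 37, right associativity)
  : cat_scope.
Notation "f ▷ X" := (tensor_hom f (idm X)) (at level 38, left associativity)
  : cat_scope.

(** * Rewriting inside composites and cancelling isomorphisms *)

Section AbCategory.
Variable C : ab_category.
Implicit Types U V W X Y Z T : C.

Lemma compA W X Y Z (a : Hom Y Z) (b : Hom X Y) (c : Hom W X) :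
  a ∘ b ∘ c = a ∘ (b ∘ c).
Proof. by rewrite comp_assoc. Qed.

(* [preN] lets an equation on a composite of [N] morphisms be used
   inside a longer right-nested composite. *)
Lemma pre2 X Y Z (a : Hom Y Z) (b : Hom X Y) (r : Hom X Z) :
  a ∘ b = r -> forall T (x : Hom T X), a ∘ (b ∘ x) = r ∘ x.
Proof. by move=> <- T x; rewrite comp_assoc. Qed.

Lemma pre3 W X Y Z (a : Hom Y Z) (b : Hom X Y) (c : Hom W X) (r : Hom W Z) :
  a ∘ (b ∘ c) = r -> forall T (x : Hom T W), a ∘ (b ∘ (c ∘ x)) = r ∘ x.
Proof. by move=> <- T x; rewrite !comp_assoc. Qed.

Lemma pre4 W W' X Y Z (a : Hom Y Z) (b : Hom X Y) (c : Hom W X) (d : Hom W' W)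
    (r : Hom W' Z) :
  a ∘ (b ∘ (c ∘ d)) = r ->
  forall T (x : Hom T W'), a ∘ (b ∘ (c ∘ (d ∘ x))) = r ∘ x.
Proof. by move=> <- T x; rewrite !comp_assoc. Qed.

Lemma iso_epi U V W (i : Hom U V) (j : Hom V U) (f g : Hom V W) :
  i ∘ j = idm V -> f ∘ i = g ∘ i -> f = g.
Proof.
by move=> ij fg; rewrite -[f]comp_idr -[g]comp_idr -ij !comp_assoc fg.
Qed.

Lemma iso_mono U V W (i : Hom V W) (j : Hom W V) (f g : Hom U V) :
  j ∘ i = idm V -> i ∘ f = i ∘ g -> f = g.
Proof.
by move=> ji fg; rewrite -[f]comp_idl -[g]comp_idl -ji -!comp_assoc fg.
Qed.

Lemma idem_iso V (e e' : Hom V V) : e' ∘ e = idm V -> e ∘ e = e -> e = idm V.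
Proof. by move=> e'e ee; apply: (iso_mono e'e); rewrite ee comp_idr. Qed.

End AbCategory.

(** * Whiskering, and the coherence identities that follow from the pentagon and the triangle *)

Section Tensor.
Variable C : tensor_category.
Implicit Types U V W X Y Z A B P Q : C.

Lemma wl_comp V X Y Z (g : Hom Y Z) (f : Hom X Y) :
  V ◁ (g ∘ f) = V ◁ g ∘ V ◁ f.
Proof. by rewrite -tensor_comp comp_idl. Qed.

Lemma wr_comp V X Y Z (g : Hom Y Z) (f : Hom X Y) :
  (g ∘ f) ▷ V = g ▷ V ∘ f ▷ V.
Proof. by rewrite -tensor_comp comp_idl. Qed.

Lemma wl2 V X Y Z (a : Hom Y Z) (b : Hom X Y) (r : Hom X Z) :
  a ∘ b = r -> V ◁ a ∘ V ◁ b = V ◁ r.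
Proof. by move=> <-; rewrite wl_comp. Qed.

Lemma wl3 V W X Y Z (a : Hom Y Z) (b : Hom X Y) (c : Hom W X) (r : Hom W Z) :
  a ∘ (b ∘ c) = r -> V ◁ a ∘ (V ◁ b ∘ V ◁ c) = V ◁ r.
Proof. by move=> <-; rewrite !wl_comp. Qed.

Lemma wr2 V X Y Z (a : Hom Y Z) (b : Hom X Y) (r : Hom X Z) :
  a ∘ b = r -> a ▷ V ∘ b ▷ V = r ▷ V.
Proof. by move=> <-; rewrite wr_comp. Qed.

Lemma interchange V V' X Y (f : Hom V V') (g : Hom X Y) :
  f ▷ Y ∘ V ◁ g = V' ◁ g ∘ f ▷ X.
Proof. by rewrite -!tensor_comp !comp_idl !comp_idr. Qed.

Lemma assocK U V W : assoc_inv U V W ∘ assoc U V W = idm _.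
Proof. by case: (assoc_inverse U V W). Qed.
Lemma assocVK U V W : assoc U V W ∘ assoc_inv U V W = idm _.
Proof. by case: (assoc_inverse U V W). Qed.
Lemma lunitK V : lunit_inv V ∘ lunit V = idm _.
Proof. by case: (lunit_inverse V). Qed.
Lemma lunitVK V : lunit V ∘ lunit_inv V = idm _.
Proof. by case: (lunit_inverse V). Qed.
Lemma runitK V : runit_inv V ∘ runit V = idm _.
Proof. by case: (runit_inverse V). Qed.
Lemma runitVK V : runit V ∘ runit_inv V = idm _.
Proof. by case: (runit_inverse V). Qed.

Lemma assoc_nat3 U V X Y (h : Hom X Y) :
  assoc U V Y ∘ (U ⊗ V) ◁ h = U ◁ V ◁ h ∘ assoc U V X.
Proof. by rewrite -tensor_id assoc_natural. Qed.

Lemma assoc_nat1 U U' V W (f : Hom U U') :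
  assoc U' V W ∘ f ▷ V ▷ W = f ▷ (V ⊗ W) ∘ assoc U V W.
Proof. by rewrite assoc_natural tensor_id. Qed.

Lemma assocV_nat3 U V X Y (h : Hom X Y) :
  assoc_inv U V Y ∘ U ◁ V ◁ h = (U ⊗ V) ◁ h ∘ assoc_inv U V X.
Proof.
apply: (iso_epi (assocVK U V X)); rewrite -!comp_assoc assocK comp_idr.
by rewrite -assoc_nat3 (pre2 (assocK _ _ _)) comp_idl.
Qed.

Lemma assocV_nat1 U U' V W (f : Hom U U') :
  assoc_inv U' V W ∘ f ▷ (V ⊗ W) = f ▷ V ▷ W ∘ assoc_inv U V W.
Proof.
apply: (iso_epi (assocVK U V W)); rewrite -!comp_assoc assocK comp_idr.
by rewrite -assoc_nat1 (pre2 (assocK _ _ _)) comp_idl.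
Qed.

Lemma assocV_nat2 U V V' W (f : Hom V V') :
  assoc_inv U V' W ∘ U ◁ (f ▷ W) = (U ◁ f) ▷ W ∘ assoc_inv U V W.
Proof.
apply: (iso_epi (assocVK U V W)); rewrite -!comp_assoc assocK comp_idr.
by rewrite -assoc_natural (pre2 (assocK _ _ _)) comp_idl.
Qed.

Lemma lunitV_nat V V' (f : Hom V V') : lunit_inv V' ∘ f = 𝟙 ◁ f ∘ lunit_inv V.
Proof.
apply: (iso_epi (lunitVK V)); rewrite -!comp_assoc lunitK comp_idr.
by rewrite -lunit_natural (pre2 (lunitK _)) comp_idl.
Qed.

Lemma wl_unit_inj X Y (f g : Hom X Y) : 𝟙 ◁ f = 𝟙 ◁ g -> f = g.
Proof.
by move=> fg; apply: (iso_epi (lunitVK X)); rewrite -!lunit_natural fg.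
Qed.

Lemma wr_unit_inj X Y (f g : Hom X Y) : f ▷ 𝟙 = g ▷ 𝟙 -> f = g.
Proof.
by move=> fg; apply: (iso_epi (runitVK X)); rewrite -!runit_natural fg.
Qed.

(** Kelly's argument: whiskering by [𝟙] is faithful, and after precomposition with the isomorphism
    of [i1] the pentagon and two triangles identify both sides. *)
Lemma lunit_tensor V W : lunit (V ⊗ W) ∘ assoc 𝟙 V W = lunit V ▷ W.
Proof.
apply: wl_unit_inj.
have i1 : (assoc 𝟙 (𝟙 ⊗ V) W ∘ assoc 𝟙 𝟙 V ▷ W) ∘
    (assoc_inv 𝟙 𝟙 V ▷ W ∘ assoc_inv 𝟙 (𝟙 ⊗ V) W) = idm _.
  rewrite -!comp_assoc (pre2 (wr2 _ (assocVK _ _ _))) tensor_id comp_idl.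
  exact: assocVK.
apply: (iso_epi i1).
rewrite wl_comp comp_assoc -!comp_assoc (comp_assoc (𝟙 ◁ assoc _ _ _)) pentagon.
rewrite (pre2 (triangle _ _)) -assoc_nat1 -triangle wr_comp.
by rewrite comp_assoc assoc_natural -!comp_assoc.
Qed.

(** Naturality of [lunit] at the morphism [lunit V] itself, with the outer [lunit V] cancelled. *)
Lemma lunit_unit V : lunit (𝟙 ⊗ V) = 𝟙 ◁ lunit V.
Proof. by apply: (iso_mono (lunitK V)); rewrite lunit_natural. Qed.

Lemma lunitV_unit V : lunit_inv (𝟙 ⊗ V) = 𝟙 ◁ lunit_inv V.
Proof.
apply: (iso_epi (lunitVK (𝟙 ⊗ V))).
by rewrite lunitK lunit_unit -wl_comp lunitK tensor_id.
Qed.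

Lemma triangleV U V : assoc_inv U 𝟙 V ∘ U ◁ lunit_inv V = runit_inv U ▷ V.
Proof.
have rK : runit U ▷ V ∘ runit_inv U ▷ V = idm _.
  by rewrite -wr_comp runitVK tensor_id.
have rK' : runit_inv U ▷ V ∘ runit U ▷ V = idm _.
  by rewrite -wr_comp runitK tensor_id.
apply: (iso_mono rK'); rewrite rK -triangle -!comp_assoc.
by rewrite (pre2 (assocVK _ _ _)) comp_idl -wl_comp lunitVK tensor_id.
Qed.

Lemma lunitV_tensor V W : assoc_inv 𝟙 V W ∘ lunit_inv (V ⊗ W) = lunit_inv V ▷ W.
Proof.
have lK : lunit V ▷ W ∘ lunit_inv V ▷ W = idm _.
  by rewrite -wr_comp lunitVK tensor_id.
have lK' : lunit_inv V ▷ W ∘ lunit V ▷ W = idm _.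
  by rewrite -wr_comp lunitK tensor_id.
apply: (iso_mono lK'); rewrite lK -lunit_tensor -!comp_assoc.
by rewrite (pre2 (assocVK _ _ _)) comp_idl lunitVK.
Qed.

Lemma pentagon_wr U V W X :
  assoc U (V ⊗ W) X ∘ assoc U V W ▷ X
  = U ◁ assoc_inv V W X ∘ (assoc U V (W ⊗ X) ∘ assoc (U ⊗ V) W X).
Proof.
rewrite -pentagon -!comp_assoc (pre2 (wl2 _ (assocK _ _ _))) tensor_id.
by rewrite comp_idl.
Qed.

Lemma pentagonV_wr U V W X :
  assoc_inv U V W ▷ X ∘ assoc_inv U (V ⊗ W) X
  = assoc_inv (U ⊗ V) W X ∘ (assoc_inv U V (W ⊗ X) ∘ U ◁ assoc V W X).
Proof.
have i1 : (assoc U (V ⊗ W) X ∘ assoc U V W ▷ X) ∘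
    (assoc_inv U V W ▷ X ∘ assoc_inv U (V ⊗ W) X) = idm _.
  rewrite -!comp_assoc (pre2 (wr2 _ (assocVK _ _ _))) tensor_id comp_idl.
  exact: assocVK.
have i2 : (assoc_inv U V W ▷ X ∘ assoc_inv U (V ⊗ W) X) ∘
    (assoc U (V ⊗ W) X ∘ assoc U V W ▷ X) = idm _.
  rewrite -!comp_assoc (pre2 (assocK _ _ _)) comp_idl.
  by rewrite (wr2 _ (assocK _ _ _)) tensor_id.
apply: (iso_mono i2); rewrite i1 pentagon_wr -!comp_assoc.
rewrite (pre2 (assocVK _ _ _)) comp_idl (pre2 (assocVK _ _ _)) comp_idl.
by rewrite (wl2 _ (assocK _ _ _)) tensor_id.
Qed.

Lemma pentagonV_wl U V W X :
  assoc_inv U (V ⊗ W) X ∘ U ◁ assoc_inv V W X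
  = assoc U V W ▷ X ∘ (assoc_inv (U ⊗ V) W X ∘ assoc_inv U V (W ⊗ X)).
Proof.
rewrite -[LHS]comp_idl -(tensor_id (U ⊗ (V ⊗ W))) -(assocVK U V W) wr_comp.
rewrite -!comp_assoc (pre2 (pentagonV_wr _ _ _ _)) -!comp_assoc.
by rewrite (wl2 _ (assocVK _ _ _)) tensor_id comp_idr.
Qed.

Lemma pentagon_wl U V W X :
  U ◁ assoc V W X ∘ assoc U (V ⊗ W) X
  = assoc U V (W ⊗ X) ∘ (assoc (U ⊗ V) W X ∘ assoc_inv U V W ▷ X).
Proof.
rewrite comp_assoc -pentagon -!comp_assoc (wr2 _ (assocVK _ _ _)) tensor_id.
by rewrite comp_idr.
Qed.

End Tensor.

(** * Two-strand morphisms acting on the left of a tail *)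

Section Tails.
Variable C : tensor_category.
Implicit Types U V W X Y Z A B P Q : C.

(* [act2], [ins] and [del] are locked so that rewriting with laws of [∘] does not
   unfold them. *)
Definition act2 V W V' W' (f : Hom (V ⊗ W) (V' ⊗ W')) X :
    Hom (V ⊗ (W ⊗ X)) (V' ⊗ (W' ⊗ X)) :=
  locked (assoc V' W' X ∘ (f ▷ X ∘ assoc_inv V W X)).

Definition ins A B (b : Hom 𝟙 (A ⊗ B)) X : Hom X (A ⊗ (B ⊗ X)) :=
  locked (assoc A B X ∘ (b ▷ X ∘ lunit_inv X)).

Definition del A B (d : Hom (A ⊗ B) 𝟙) X : Hom (A ⊗ (B ⊗ X)) X :=
  locked (lunit X ∘ (d ▷ X ∘ assoc_inv A B X)).

Lemma act2E V W V' W' (f : Hom (V ⊗ W) (V' ⊗ W')) X :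
  act2 f X = assoc V' W' X ∘ (f ▷ X ∘ assoc_inv V W X).
Proof. by rewrite /act2 -lock. Qed.
Lemma insE A B (b : Hom 𝟙 (A ⊗ B)) X :
  ins b X = assoc A B X ∘ (b ▷ X ∘ lunit_inv X).
Proof. by rewrite /ins -lock. Qed.
Lemma delE A B (d : Hom (A ⊗ B) 𝟙) X :
  del d X = lunit X ∘ (d ▷ X ∘ assoc_inv A B X).
Proof. by rewrite /del -lock. Qed.

Lemma act2_nat V W V' W' (f : Hom (V ⊗ W) (V' ⊗ W')) X Y (k : Hom X Y) :
  act2 f Y ∘ V ◁ W ◁ k = V' ◁ W' ◁ k ∘ act2 f X.
Proof.
rewrite !act2E -!comp_assoc assocV_nat3 (pre2 (interchange _ _)).
by rewrite -comp_assoc (pre2 (assoc_nat3 _ _ _)) -comp_assoc.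
Qed.

Lemma ins_nat A B (b : Hom 𝟙 (A ⊗ B)) X Y (k : Hom X Y) :
  ins b Y ∘ k = A ◁ B ◁ k ∘ ins b X.
Proof.
rewrite !insE -!comp_assoc lunitV_nat (pre2 (interchange _ _)).
by rewrite -comp_assoc (pre2 (assoc_nat3 _ _ _)) -comp_assoc.
Qed.

Lemma del_nat A B (d : Hom (A ⊗ B) 𝟙) X Y (k : Hom X Y) :
  del d Y ∘ A ◁ B ◁ k = k ∘ del d X.
Proof.
rewrite !delE -!comp_assoc assocV_nat3 (pre2 (interchange _ _)).
by rewrite -comp_assoc (pre2 (lunit_natural _)) -comp_assoc.
Qed.

Lemma act2_comp V W V' W' V'' W'' (g : Hom (V' ⊗ W') (V'' ⊗ W''))
    (f : Hom (V ⊗ W) (V' ⊗ W')) X :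
  act2 (g ∘ f) X = act2 g X ∘ act2 f X.
Proof.
by rewrite !act2E -!comp_assoc (pre2 (assocK _ _ _)) comp_idl wr_comp -comp_assoc.
Qed.

Lemma ins_comp A B A' B' (f : Hom (A ⊗ B) (A' ⊗ B')) (b : Hom 𝟙 (A ⊗ B)) X :
  ins (f ∘ b) X = act2 f X ∘ ins b X.
Proof.
rewrite act2E !insE -!comp_assoc (pre2 (assocK _ _ _)) comp_idl wr_comp.
by rewrite -comp_assoc.
Qed.

Lemma del_comp A B A' B' (d : Hom (A' ⊗ B') 𝟙) (f : Hom (A ⊗ B) (A' ⊗ B')) X :
  del (d ∘ f) X = del d X ∘ act2 f X.
Proof.
rewrite act2E !delE -!comp_assoc (pre2 (assocK _ _ _)) comp_idl wr_comp.
by rewrite -comp_assoc.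
Qed.

Lemma act2_id V W X : act2 (idm (V ⊗ W)) X = idm _.
Proof. by rewrite act2E tensor_id comp_idl assocVK. Qed.

Lemma act2_wr V V' W (f : Hom V V') X : act2 (f ▷ W) X = f ▷ (W ⊗ X).
Proof. by rewrite act2E -assocV_nat1 (pre2 (assocVK _ _ _)) comp_idl. Qed.

Lemma act2_wl V W W' (f : Hom W W') X : act2 (V ◁ f) X = V ◁ (f ▷ X).
Proof. by rewrite act2E -assocV_nat2 (pre2 (assocVK _ _ _)) comp_idl. Qed.

End Tails.

Notation flatE := (compA, @wl_comp, comp_idl, comp_idr, tensor_id).

(** * Crossings on tails: hexagons, crossings with the unit, sliding moves *)

Section Braided.
Variable C : braided_category.
Implicit Types U V W X Y Z A B P Q : C.

Definition br V W X : Hom (V ⊗ (W ⊗ X)) (W ⊗ (V ⊗ X)) := act2 (braid V W) X.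

Lemma br_nat V W X Y (k : Hom X Y) :
  br V W Y ∘ V ◁ W ◁ k = W ◁ V ◁ k ∘ br V W X.
Proof. exact: act2_nat. Qed.

Lemma br_nat1 V V' W (f : Hom V V') X :
  br V' W X ∘ f ▷ (W ⊗ X) = W ◁ (f ▷ X) ∘ br V W X.
Proof. by rewrite -act2_wr -act2_wl -!act2_comp braid_natural. Qed.

Lemma br_nat2 V W W' (f : Hom W W') X :
  br V W' X ∘ V ◁ (f ▷ X) = f ▷ (V ⊗ X) ∘ br V W X.
Proof. by rewrite -act2_wr -act2_wl -!act2_comp braid_natural. Qed.

Lemma br_iso V W X :
  exists g, g ∘ br V W X = idm _ /\ br V W X ∘ g = idm _.
Proof.
have [g [gK Kg]] := braid_iso V W; exists (act2 g X).
by rewrite -!act2_comp gK Kg !act2_id.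
Qed.

(** The first hexagon whiskered by the tail [X]. Naturality ([e1], [e2]) and pentagons ([p1], [p2])
    push the associators outwards until only the hexagon is left. *)
Lemma br_tensor_r U V W X :
  V ◁ br U W X ∘ br U V (W ⊗ X)
  = assoc V W (U ⊗ X) ∘ (br U (V ⊗ W) X ∘ U ◁ assoc_inv V W X).
Proof.
have e1 : V ◁ (assoc W U X ∘ (braid U W ▷ X ∘ assoc_inv U W X))
    = V ◁ assoc W U X ∘ (assoc V (W ⊗ U) X ∘ ((V ◁ braid U W) ▷ X
       ∘ (assoc_inv V (U ⊗ W) X ∘ V ◁ assoc_inv U W X))).
  rewrite !wl_comp; congr (_ ∘ _).
  by rewrite !comp_assoc assoc_natural -!comp_assoc (pre2 (assocVK _ _ _)) ?flatE.
have e2 : assoc V U (W ⊗ X) ∘ (braid U V ▷ (W ⊗ X) ∘ assoc_inv U V (W ⊗ X))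
    = assoc V U (W ⊗ X) ∘ (assoc (V ⊗ U) W X ∘ ((braid U V ▷ W) ▷ X
       ∘ (assoc_inv (U ⊗ V) W X ∘ assoc_inv U V (W ⊗ X)))).
  congr (_ ∘ _).
  by rewrite !comp_assoc assoc_nat1 -!comp_assoc (pre2 (assocVK _ _ _)) ?flatE.
rewrite /br !act2E e1 e2 -!comp_assoc.
have p1 : assoc_inv V (U ⊗ W) X ∘ (V ◁ assoc_inv U W X ∘ (assoc V U (W ⊗ X) ∘
    assoc (V ⊗ U) W X)) = assoc V U W ▷ X.
  by rewrite -pentagon_wr (pre2 (assocK _ _ _)) ?flatE.
rewrite (pre4 p1).
have p2 : assoc_inv (U ⊗ V) W X ∘ assoc_inv U V (W ⊗ X)
    = assoc_inv U V W ▷ X ∘ (assoc_inv U (V ⊗ W) X ∘ U ◁ assoc_inv V W X).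
  rewrite comp_assoc pentagonV_wr -!comp_assoc.
  by rewrite (wl2 _ (assocVK _ _ _)) tensor_id comp_idr.
rewrite p2.
rewrite (pre2 (pentagon_wl _ _ _ _)) -!comp_assoc; congr (_ ∘ (_ ∘ _)).
rewrite !comp_assoc -!wr_comp -!comp_assoc; congr (_ ∘ _); congr (_ ▷ _).
rewrite !comp_assoc -(comp_assoc _ (assoc V U W)).
rewrite -!comp_assoc (comp_assoc (V ◁ _)) (comp_assoc (V ◁ _ ∘ _)) -hexagon1.
by rewrite -!comp_assoc (pre2 (assocK _ _ _)) ?flatE; rewrite assocVK comp_idr.
Qed.

(** The second hexagon with a tail, obtained in the same way. *)
Lemma br_tensor_l U V W X :
  br U W (V ⊗ X) ∘ U ◁ br V W X
  = W ◁ assoc U V X ∘ (br (U ⊗ V) W X ∘ assoc_inv U V (W ⊗ X)).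
Proof.
have e1 : U ◁ (assoc W V X ∘ (braid V W ▷ X ∘ assoc_inv V W X))
    = U ◁ assoc W V X ∘ (assoc U (W ⊗ V) X ∘ ((U ◁ braid V W) ▷ X
       ∘ (assoc_inv U (V ⊗ W) X ∘ U ◁ assoc_inv V W X))).
  rewrite !wl_comp; congr (_ ∘ _).
  by rewrite !comp_assoc assoc_natural -!comp_assoc (pre2 (assocVK _ _ _)) ?flatE.
have e2 : assoc W U (V ⊗ X) ∘ (braid U W ▷ (V ⊗ X) ∘ assoc_inv U W (V ⊗ X))
    = assoc W U (V ⊗ X) ∘ (assoc (W ⊗ U) V X ∘ ((braid U W ▷ V) ▷ X
       ∘ (assoc_inv (U ⊗ W) V X ∘ assoc_inv U W (V ⊗ X)))).
  congr (_ ∘ _).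
  by rewrite !comp_assoc assoc_nat1 -!comp_assoc (pre2 (assocVK _ _ _)) ?flatE.
rewrite /br !act2E e1 e2 -!comp_assoc.
have p1 : assoc_inv (U ⊗ W) V X ∘ (assoc_inv U W (V ⊗ X) ∘ (U ◁ assoc W V X ∘
    assoc U (W ⊗ V) X)) = assoc_inv U W V ▷ X.
  rewrite (pre3 (esym (pentagonV_wr _ _ _ _))) -!comp_assoc assocK.
  by rewrite comp_idr.
rewrite (pre4 p1).
rewrite pentagonV_wl.
have p3 : assoc W U (V ⊗ X) ∘ assoc (W ⊗ U) V X
    = W ◁ assoc U V X ∘ (assoc W (U ⊗ V) X ∘ assoc W U V ▷ X).
  by rewrite -pentagon -!comp_assoc.
rewrite (pre2 p3) -!comp_assoc; congr (_ ∘ (_ ∘ _)).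
rewrite !comp_assoc -!wr_comp -!comp_assoc; congr (_ ∘ _); congr (_ ▷ _).
have h := hexagon2 U V W; rewrite -!comp_assoc in h.
rewrite (pre3 (esym h)) -!comp_assoc assocK comp_idr.
by rewrite (pre2 (assocVK _ _ _)) ?flatE.
Qed.

(** Read through the unit constraints, the crossing with [𝟙] is an endomorphism [e] with a left
    inverse. The hexagon for [𝟙 ⊗ 𝟙] makes [e] idempotent, so it is the identity. *)
Lemma br_unit_r A X : br A 𝟙 X = lunit_inv (A ⊗ X) ∘ A ◁ lunit X.
Proof.
pose e Y := lunit (A ⊗ Y) ∘ (br A 𝟙 Y ∘ A ◁ lunit_inv Y).
have e_nat Y Z (k : Hom Y Z) : e Z ∘ A ◁ k = A ◁ k ∘ e Y.
  rewrite /e -!comp_assoc -wl_comp lunitV_nat wl_comp.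
  by rewrite (pre2 (br_nat _ _ _)) -!comp_assoc (pre2 (lunit_natural _)) -comp_assoc.
have brE Y : lunit (A ⊗ Y) ∘ br A 𝟙 Y = e Y ∘ A ◁ lunit Y.
  by rewrite /e -!comp_assoc -wl_comp lunitK tensor_id comp_idr.
suff e_id : e X = idm _.
  by rewrite -[LHS]comp_idl -lunitK -comp_assoc brE e_id comp_idl.
have [g [gK _]] := br_iso A 𝟙 X.
have e'e : (A ◁ lunit X ∘ (g ∘ lunit_inv _)) ∘ e X = idm _.
  rewrite /e -!comp_assoc (pre2 (lunitK _)) comp_idl (pre2 gK) comp_idl.
  by rewrite -wl_comp lunitVK tensor_id.
apply: (idem_iso e'e).
have eE Y : lunit (A ⊗ Y) ∘ (br A 𝟙 Y ∘ A ◁ lunit_inv Y) = e Y by [].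
clearbody e.
(* Two successive crossings with [𝟙]: taken one at a time they give [e ∘ e], while [br_tensor_r]
   merges them into a single one, that is [e]. *)
transitivity (lunit (A ⊗ X) ∘ (𝟙 ◁ lunit (A ⊗ X) ∘ (𝟙 ◁ br A 𝟙 X ∘
  (br A 𝟙 (𝟙 ⊗ X) ∘ (A ◁ lunit_inv (𝟙 ⊗ X) ∘ A ◁ lunit_inv X))))).
  rewrite (pre2 (esym (wl_comp _ _ _))) (pre2 (lunit_natural _)) brE -!comp_assoc.
  by rewrite (pre3 (eE _)) e_nat (pre2 (wl2 _ (lunitVK _))) ?flatE.
rewrite -[RHS]eE (pre2 (br_tensor_r _ _ _ _)) -!comp_assoc (pre2 (triangle _ _)).
rewrite (pre2 (esym (br_nat2 _ _ _))) -!comp_assoc lunitV_unit.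
congr (_ ∘ (_ ∘ _)); rewrite -!wl_comp; congr (_ ◁ _).
by rewrite (pre2 (triangleV _ _)) comp_assoc -wr_comp runitVK tensor_id comp_idl.
Qed.

Lemma br_unit_l A X : br 𝟙 A X = A ◁ lunit_inv X ∘ lunit (A ⊗ X).
Proof.
pose e Y := A ◁ lunit Y ∘ (br 𝟙 A Y ∘ lunit_inv (A ⊗ Y)).
have e_nat Y Z (k : Hom Y Z) : e Z ∘ A ◁ k = A ◁ k ∘ e Y.
  rewrite /e -!comp_assoc lunitV_nat (pre2 (br_nat _ _ _)) -!comp_assoc.
  by rewrite !comp_assoc -!wl_comp lunit_natural.
have brE Y : A ◁ lunit Y ∘ br 𝟙 A Y = e Y ∘ lunit (A ⊗ Y).
  by rewrite /e -!comp_assoc lunitK comp_idr.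
suff e_id : e X = idm _.
  rewrite -[LHS]comp_idl -tensor_id -lunitK wl_comp -comp_assoc brE e_id.
  by rewrite comp_idl.
have [g [gK _]] := br_iso 𝟙 A X.
have e'e : (lunit _ ∘ (g ∘ A ◁ lunit_inv X)) ∘ e X = idm _.
  rewrite /e -!comp_assoc (pre2 (wl2 _ (lunitK _))) ?flatE (pre2 gK) ?flatE.
  by rewrite lunitVK.
apply: (idem_iso e'e).
have eE Y : A ◁ lunit Y ∘ (br 𝟙 A Y ∘ lunit_inv (A ⊗ Y)) = e Y by [].
clearbody e.
transitivity (A ◁ lunit X ∘ (A ◁ lunit (𝟙 ⊗ X) ∘ (br 𝟙 A (𝟙 ⊗ X) ∘
  (𝟙 ◁ br 𝟙 A X ∘ (lunit_inv (𝟙 ⊗ (A ⊗ X)) ∘ lunit_inv (A ⊗ X)))))).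
  rewrite (pre2 (brE _)) -!comp_assoc (pre2 (lunit_natural _)) -comp_assoc.
  rewrite (pre2 (lunitVK _)) comp_idl (pre2 (esym (e_nat _ _ _))) -comp_assoc.
  by rewrite eE.
rewrite -[RHS]eE (pre2 (br_tensor_l _ _ _ _)) -!comp_assoc.
rewrite lunit_unit (pre2 (wl2 _ (triangle _ _))).
rewrite (pre2 (esym (br_nat1 _ _ _))) -!comp_assoc.
congr (_ ∘ (_ ∘ _)); rewrite lunitV_unit.
by rewrite (pre2 (triangleV _ _)) comp_assoc -wr_comp runitVK tensor_id comp_idl.
Qed.

(** Naturality of the braiding along [b]: crossing [P ⊗ Q] amounts to two crossings, crossing [𝟙] to
    none. The next lemmas are the variants for the other side, for [del] and for [act2]. *)
Lemma br_ins_r A P Q (b : Hom 𝟙 (P ⊗ Q)) X :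
  P ◁ br A Q X ∘ (br A P (Q ⊗ X) ∘ A ◁ ins b X) = ins b (A ⊗ X).
Proof.
rewrite comp_assoc br_tensor_r !insE ?flatE.
rewrite (pre2 (wl2 _ (assocK _ _ _))) ?flatE (pre2 (br_nat2 _ _ _)) ?flatE.
by rewrite br_unit_r ?flatE; rewrite (wl2 _ (lunitVK _)) ?flatE.
Qed.

Lemma br_ins_l A P Q (b : Hom 𝟙 (P ⊗ Q)) X :
  br P A (Q ⊗ X) ∘ (P ◁ br Q A X ∘ ins b (A ⊗ X)) = A ◁ ins b X.
Proof.
rewrite comp_assoc br_tensor_l !insE ?flatE.
rewrite (pre2 (assocK _ _ _)) ?flatE (pre2 (br_nat1 _ _ _)) ?flatE.
by rewrite br_unit_l ?flatE; rewrite (lunitVK _) ?flatE.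
Qed.

Lemma br_del_r A P Q (d : Hom (P ⊗ Q) 𝟙) X :
  del d (A ⊗ X) ∘ (P ◁ br A Q X ∘ br A P (Q ⊗ X)) = A ◁ del d X.
Proof.
rewrite br_tensor_r !delE ?flatE.
rewrite (pre2 (assocK _ _ _)) ?flatE (pre2 (esym (br_nat2 _ _ _))) ?flatE.
by rewrite br_unit_r ?flatE (pre2 (lunitVK _)) ?flatE.
Qed.

Lemma br_del_l A P Q (d : Hom (P ⊗ Q) 𝟙) X :
  A ◁ del d X ∘ (br P A (Q ⊗ X) ∘ P ◁ br Q A X) = del d (A ⊗ X).
Proof.
rewrite br_tensor_l !delE ?flatE.
rewrite (pre2 (wl2 _ (assocK _ _ _))) ?flatE (pre2 (esym (br_nat1 _ _ _))) ?flatE.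
by rewrite br_unit_l ?flatE (pre2 (wl2 _ (lunitVK _))) ?flatE.
Qed.

Lemma br_act2_r A P Q P' Q' (f : Hom (P ⊗ Q) (P' ⊗ Q')) X :
  P' ◁ br A Q' X ∘ (br A P' (Q' ⊗ X) ∘ A ◁ act2 f X)
  = act2 f (A ⊗ X) ∘ (P ◁ br A Q X ∘ br A P (Q ⊗ X)).
Proof.
rewrite comp_assoc !br_tensor_r !act2E ?flatE.
rewrite (pre2 (wl2 _ (assocK _ _ _))) ?flatE (pre2 (assocK _ _ _)) ?flatE.
by rewrite (pre2 (br_nat2 _ _ _)) ?flatE.
Qed.

Lemma br_act2_l A P Q P' Q' (f : Hom (P ⊗ Q) (P' ⊗ Q')) X :
  br P' A (Q' ⊗ X) ∘ (P' ◁ br Q' A X ∘ act2 f (A ⊗ X))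
  = A ◁ act2 f X ∘ (br P A (Q ⊗ X) ∘ P ◁ br Q A X).
Proof.
rewrite comp_assoc !br_tensor_l !act2E ?flatE.
rewrite (pre2 (wl2 _ (assocK _ _ _))) ?flatE (pre2 (assocK _ _ _)) ?flatE.
by rewrite (pre2 (br_nat1 _ _ _)) ?flatE.
Qed.

End Braided.

(** * The constituents of [trR] and [trL] rewritten on tails *)

Section PentagonTails.
Variable C : tensor_category.
Implicit Types U V W X Y Z : C.

Lemma wr_del U W D (d : Hom (W ⊗ D) 𝟙) X :
  (runit U ∘ (U ◁ d ∘ assoc U W D)) ▷ X
  = U ◁ del d X ∘ (assoc U W (D ⊗ X) ∘ assoc (U ⊗ W) D X).
Proof.
rewrite delE !wr_comp -triangle ?flatE.
rewrite (pre2 (assoc_natural _ _ _)) ?flatE.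
by rewrite pentagon_wr.
Qed.

Lemma wr_ins U W D (b : Hom 𝟙 (W ⊗ D)) X :
  (assoc_inv U W D ∘ (U ◁ b ∘ runit_inv U)) ▷ X
  = assoc_inv (U ⊗ W) D X ∘ (assoc_inv U W (D ⊗ X) ∘ U ◁ ins b X).
Proof.
rewrite insE !wr_comp -triangleV ?flatE.
rewrite (pre2 (esym (assocV_nat2 _ _ _))) ?flatE.
by rewrite (pre2 (pentagonV_wr _ _ _ _)) ?flatE.
Qed.

Lemma wr_lunit_del D W A (d : Hom (D ⊗ W) 𝟙) X :
  (lunit A ∘ (d ▷ A ∘ assoc_inv D W A)) ▷ X
  = del d (A ⊗ X) ∘ (D ◁ assoc W A X ∘ assoc D (W ⊗ A) X).
Proof.
rewrite delE !wr_comp -lunit_tensor ?flatE.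
rewrite (pre2 (assoc_nat1 _ _ _)) ?flatE; congr (_ ∘ (_ ∘ _)).
by rewrite pentagon_wl (pre2 (assocK _ _ _)) ?flatE.
Qed.

Lemma wr_lunit_ins D W A (b : Hom 𝟙 (D ⊗ W)) X :
  (assoc D W A ∘ (b ▷ A ∘ lunit_inv A)) ▷ X
  = assoc_inv D (W ⊗ A) X ∘ (D ◁ assoc_inv W A X ∘ ins b (A ⊗ X)).
Proof.
rewrite insE !wr_comp -lunitV_tensor ?flatE.
rewrite (pre2 (pentagonV_wl _ _ _ _)) ?flatE.
by rewrite (pre2 (assocK _ _ _)) ?flatE (pre2 (assocV_nat1 _ _ _)) ?flatE.
Qed.

Lemma act2_conj_assoc U U' V W (f : Hom (U ⊗ (V ⊗ W)) (U' ⊗ (V ⊗ W))) X :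
  assoc U' V (W ⊗ X) ∘ (act2 (assoc_inv U' V W ∘ (f ∘ assoc U V W)) X
     ∘ assoc_inv U V (W ⊗ X))
  = U' ◁ assoc V W X ∘ (act2 f X ∘ U ◁ assoc_inv V W X).
Proof.
rewrite !act2E !wr_comp ?flatE pentagonV_wl.
by rewrite (pre2 (pentagon_wl _ _ _ _)) ?flatE.
Qed.

Lemma act2_conj_wl V U U' W (f : Hom (U ⊗ W) (U' ⊗ W)) X :
  act2 (assoc_inv V U' W ∘ (V ◁ f ∘ assoc V U W)) X
  = assoc_inv V U' (W ⊗ X) ∘ (V ◁ act2 f X ∘ assoc V U (W ⊗ X)).
Proof.
have l : assoc (V ⊗ U') W X ∘ assoc_inv V U' W ▷ X
    = assoc_inv V U' (W ⊗ X) ∘ (V ◁ assoc U' W X ∘ assoc V (U' ⊗ W) X).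
  by rewrite pentagon_wl (pre2 (assocK _ _ _)) ?flatE.
have r : assoc V U W ▷ X ∘ assoc_inv (V ⊗ U) W X
    = assoc_inv V (U ⊗ W) X ∘ (V ◁ assoc_inv U W X ∘ assoc V U (W ⊗ X)).
  by rewrite (pre2 (pentagonV_wl _ _ _ _)) ?flatE (assocK _ _ _) ?flatE.
rewrite !act2E !wr_comp ?flatE r (pre2 l) ?flatE.
by rewrite (pre2 (assoc_natural _ _ _)) ?flatE (pre2 (assocVK _ _ _)) ?flatE.
Qed.

End PentagonTails.

(** * The right partial trace and its relation to braiding and twist *)

Section Ribbon.
Variable C : ribbon_category.
Implicit Types U V W X Y Z A P Q J : C.

(** This is [trR] with source and target of the open strand allowed to differ, so that it is natural
    in that strand ([ptr_nat]). *)
Definition ptr U U' W (f : Hom (U ⊗ W) (U' ⊗ W)) : Hom U U' :=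
  locked (runit U' ∘ (U' ◁ ev' W) ∘ assoc U' W (W^⋆) ∘ f ▷ (W^⋆)
    ∘ assoc_inv U W (W^⋆) ∘ (U ◁ coev W) ∘ runit_inv U).

Lemma ptrE U U' W (f : Hom (U ⊗ W) (U' ⊗ W)) :
  ptr f = runit U' ∘ (U' ◁ ev' W) ∘ assoc U' W (W^⋆) ∘ f ▷ (W^⋆)
    ∘ assoc_inv U W (W^⋆) ∘ (U ◁ coev W) ∘ runit_inv U.
Proof. by rewrite /ptr -lock. Qed.

Lemma trRE U W (f : endo (U ⊗ W)) : trR f = ptr (f : Hom (U ⊗ W) (U ⊗ W)).
Proof. by rewrite ptrE. Qed.

Lemma ptr_wr U U' W (f : Hom (U ⊗ W) (U' ⊗ W)) X :
  ptr f ▷ X = U' ◁ del (ev' W) X ∘ (act2 f (W^⋆ ⊗ X) ∘ U ◁ ins (coev W) X).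
Proof.
have -> : ptr f = (runit U' ∘ (U' ◁ ev' W ∘ assoc U' W (W^⋆))) ∘
    (f ▷ (W^⋆) ∘ (assoc_inv U W (W^⋆) ∘ (U ◁ coev W ∘ runit_inv U))).
  by rewrite ptrE ?flatE.
rewrite wr_comp wr_del wr_comp wr_ins act2E ?flatE.
by rewrite (pre2 (assoc_nat1 _ _ _)) ?flatE (pre2 (assocVK _ _ _)) ?flatE.
Qed.

Lemma trL_wr V W (f : endo (V ⊗ W)) X :
  tensor_hom (trL f : Hom W W) (idm X)
  = del (ev V) (W ⊗ X) ∘ (V^⋆ ◁ act2 (f : Hom (V ⊗ W) (V ⊗ W)) X
      ∘ ins (coev' V) (W ⊗ X)).
Proof.
have -> : (trL f : Hom W W)
    = (lunit W ∘ (ev V ▷ W ∘ assoc_inv (V^⋆) V W)) ∘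
      (V^⋆ ◁ (f : Hom (V ⊗ W) (V ⊗ W)) ∘
      (assoc (V^⋆) V W ∘ (coev' V ▷ W ∘ lunit_inv W))).
  by rewrite /trL ?flatE.
rewrite wr_comp wr_lunit_del wr_comp wr_lunit_ins act2E ?flatE.
by rewrite (pre2 (assoc_natural _ _ _)) ?flatE (pre2 (assocVK _ _ _)) ?flatE.
Qed.

Lemma zigzag_tail V X : V ◁ del (ev V) X ∘ ins (coev V) (V ⊗ X) = idm (V ⊗ X).
Proof.
have := congr1 (fun f => f ▷ X) (zigzag V); rewrite tensor_id => <-.
have -> : runit V ∘ (V ◁ ev V) ∘ assoc V (V^⋆) V ∘ (coev V ▷ V) ∘ lunit_inv V
    = (runit V ∘ (V ◁ ev V ∘ assoc V (V^⋆) V)) ∘ (coev V ▷ V ∘ lunit_inv V).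
  by rewrite ?flatE.
rewrite wr_comp wr_del wr_comp -lunitV_tensor insE ?flatE.
by rewrite (pre2 (assoc_nat1 _ _ _)) ?flatE (pre2 (assocVK _ _ _)) ?flatE.
Qed.

(** Allows equations to be checked with an arbitrary tail; the tail [𝟙] is enough to come back. *)
Lemma wr_inj X Y (f g : Hom X Y) : (forall Z, f ▷ Z = g ▷ Z) -> f = g.
Proof. by move=> fg; apply: wr_unit_inj. Qed.

Lemma braid_unit : braid (𝟙 : C) 𝟙 = idm _.
Proof.
apply: wr_inj => Z; rewrite tensor_id.
have := br_unit_r (𝟙 : C) Z; rewrite -lunit_unit lunitK /br act2E => e.
rewrite -[RHS](assocK 𝟙 𝟙 Z) -[in RHS](comp_idl (assoc 𝟙 𝟙 Z)) -e ?flatE.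
by rewrite (pre2 (assocK _ _ _)) ?flatE assocK ?flatE.
Qed.

(** On [𝟙 ⊗ 𝟙] the braiding is trivial, so [twist_tensor] makes the twist of [𝟙] idempotent; it is
    also invertible. *)
Lemma twist_unit : twist (𝟙 : C) = idm _.
Proof.
have [g [gK _]] := twist_iso (𝟙 : C).
apply: (idem_iso gK); apply: (iso_epi (runitVK (𝟙 : C))).
rewrite [RHS]twist_natural twist_tensor braid_unit ?flatE.
have e : 𝟙 ◁ twist (𝟙 : C) = twist 𝟙 ▷ 𝟙.
  by have := braid_natural (idm (𝟙 : C)) (twist 𝟙); rewrite braid_unit ?flatE.
have -> : twist (𝟙 : C) ⊠ twist 𝟙 = twist 𝟙 ▷ 𝟙 ∘ 𝟙 ◁ twist 𝟙.
  by rewrite -tensor_comp ?flatE.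
by rewrite e (pre2 (runit_natural _)) ?flatE runit_natural.
Qed.

(** Naturality of the twist along [ev V]: it is trivial on [𝟙], and on [V^⋆ ⊗ V] it is a double
    crossing with a twist on each strand. [coev_twist] is the same along [coev V]. *)
Lemma ev_twist V :
  ev V ∘ (braid V (V^⋆) ∘ (twist V ▷ (V^⋆) ∘ (braid (V^⋆) V ∘ twist (V^⋆) ▷ V)))
  = ev V.
Proof.
have := twist_natural (ev V); rewrite twist_unit comp_idl => {2}->.
rewrite twist_tensor (pre2 (esym (braid_natural _ _))) ?flatE.
by rewrite -tensor_comp ?flatE.
Qed.

Lemma coev_twist V : coev V = braid (V^⋆) V ∘ (twist (V^⋆) ▷ V ∘ coev' V).
Proof.
have := twist_natural (coev V); rewrite twist_unit comp_idr => {1}<-.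
rewrite twist_tensor /coev' ?flatE; congr (_ ∘ _).
rewrite (pre2 (braid_natural _ _)) ?flatE.
have -> : twist (V^⋆) ⊠ twist V = twist (V^⋆) ▷ V ∘ V^⋆ ◁ twist V.
  by rewrite -tensor_comp ?flatE.
by rewrite ?flatE.
Qed.

Lemma del_ev' V X :
  del (ev' V) X = del (ev V) X ∘ (br V (V^⋆) X ∘ twist V ▷ (V^⋆ ⊗ X)).
Proof. by rewrite /ev' !del_comp act2_wr ?flatE. Qed.

Lemma ptr_nat U U' U'' U''' W (x : Hom U'' U''') (f : Hom (U' ⊗ W) (U'' ⊗ W))
    (y : Hom U U') :
  ptr (x ▷ W ∘ (f ∘ y ▷ W)) = x ∘ (ptr f ∘ y).
Proof.
apply: wr_inj => Z; rewrite !wr_comp !ptr_wr !act2_comp !act2_wr ?flatE.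
by rewrite (pre2 (esym (interchange _ _))) ?flatE interchange.
Qed.

Lemma ptr_add U U' W (f g : Hom (U ⊗ W) (U' ⊗ W)) : ptr (f + g) = ptr f + ptr g.
Proof. by rewrite !ptrE tensorDl !(compDl, compDr). Qed.

(** The crossing contained in [ev'] and the given one together pull the strand off [coev]. A zigzag
    remains, with the twist of [ev'] on it. *)
Lemma ptr_braid V : ptr (braid V V) = twist V.
Proof.
apply: wr_inj => Z; rewrite ptr_wr del_ev' ?flatE.
rewrite (pre2 (esym (br_nat1 _ _ _))) ?flatE interchange.
by rewrite (pre3 (br_ins_r _ _ _)) (pre2 (zigzag_tail _ _)) ?flatE.
Qed.

(** The strand [W] slides across the loop of [V] by naturality. What is left on the loop are the
    crossings and twists of [coev_twist] and [ev_twist], which turn [coev] and [ev'] into [coev']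
    and [ev]. Stating the hypothesis as an equation avoids naming an inverse braiding and serves
    both conjugations used below. *)
Lemma ptr_conj_braid V W (f : endo (V ⊗ W)) (h : Hom (W ⊗ V) (W ⊗ V)) :
  h ∘ braid V W = braid V W ∘ (f : Hom (V ⊗ W) (V ⊗ W)) ->
  ptr h = trL f.
Proof.
move=> hf; apply: wr_inj => X; rewrite trL_wr ptr_wr del_ev' ?flatE.
have hf_tail Z : act2 h Z ∘ br V W Z = br V W Z ∘ act2 (f : Hom (V ⊗ W) _) Z.
  by rewrite -!act2_comp hf.
rewrite -(br_ins_l W (coev V)) (pre2 (hf_tail _)) ?flatE.
rewrite coev_twist ins_comp (ins_comp _ (coev' V)) act2_wr.
rewrite (pre3 (esym (br_act2_r _ _ _))) ?flatE.
rewrite (pre2 (esym (interchange _ _))).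
rewrite (pre2 (esym (br_nat1 _ _ _))) ?flatE.
rewrite (pre2 (interchange _ _)) ?flatE.
rewrite (pre3 (esym (br_act2_l _ _ _))) ?flatE (pre3 (br_del_l _ _ _)).
rewrite -!act2_wr.
by rewrite -[in RHS]ev_twist !del_comp !act2_comp /br ?flatE.
Qed.

Lemma yang_baxter P Q A X :
  br Q A (P ⊗ X) ∘ (Q ◁ br P A X ∘ br P Q (A ⊗ X))
  = A ◁ br P Q X ∘ (br P A (Q ⊗ X) ∘ P ◁ br Q A X).
Proof. exact: br_act2_l. Qed.

Lemma ptr_tail_wl V U U' W (f : Hom (U ⊗ W) (U' ⊗ W)) :
  ptr (assoc_inv V U' W ∘ (V ◁ f ∘ assoc V U W)) = V ◁ ptr f.
Proof.
apply: wr_inj => X; rewrite ptr_wr.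
have -> : (V ◁ ptr f) ▷ X
    = assoc_inv V U' X ∘ (V ◁ (ptr f ▷ X) ∘ assoc V U X).
  by rewrite (pre2 (assocV_nat2 _ _ _)) ?flatE assocK ?flatE.
rewrite ptr_wr !wl_comp ?flatE (pre2 (assocV_nat3 _ _ _)) ?flatE.
by rewrite act2_conj_wl ?flatE assoc_nat3.
Qed.

(** * Sliding a morphism around the closed strand *)

(* The transpose [W^⋆ -> W'^⋆] of [g], acting on tails. *)
Definition transp W W' (g : Hom W' W) X : Hom (W^⋆ ⊗ X) (W'^⋆ ⊗ X) :=
  locked (del (ev W) (W'^⋆ ⊗ X)
    ∘ (W^⋆ ◁ (g ▷ (W'^⋆ ⊗ X)) ∘ W^⋆ ◁ ins (coev W') X)).

Lemma transpE W W' (g : Hom W' W) X :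
  transp g X = del (ev W) (W'^⋆ ⊗ X)
    ∘ (W^⋆ ◁ (g ▷ (W'^⋆ ⊗ X)) ∘ W^⋆ ◁ ins (coev W') X).
Proof. by rewrite /transp -lock. Qed.

Lemma transp_coev W W' (g : Hom W' W) X :
  W ◁ transp g X ∘ ins (coev W) X = g ▷ (W'^⋆ ⊗ X) ∘ ins (coev W') X.
Proof.
rewrite transpE ?flatE -!(ins_nat (coev W)) ?flatE.
rewrite (pre2 (esym (ins_nat (coev W) _))) ?flatE.
by rewrite (pre2 (zigzag_tail _ _)) ?flatE.
Qed.

Lemma transp_ev W W' (g : Hom W' W) X :
  del (ev W') X ∘ transp g (W' ⊗ X) = del (ev W) X ∘ W^⋆ ◁ (g ▷ X).
Proof.
rewrite transpE ?flatE (pre2 (esym (del_nat _ _))) ?flatE.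
rewrite (pre2 (wl2 _ (esym (interchange _ _)))) ?flatE.
by rewrite (wl2 _ (zigzag_tail _ _)) ?flatE.
Qed.

Lemma transp_br A W W' (g : Hom W' W) X :
  br A (W'^⋆) X ∘ A ◁ transp g X = transp g (A ⊗ X) ∘ br A (W^⋆) X.
Proof.
rewrite !transpE ?flatE -(br_ins_r A (coev W')) ?flatE.
rewrite (pre2 (wl2 _ (interchange _ _))) ?flatE.
rewrite (pre2 (del_nat _ _)) ?flatE.
rewrite (pre2 (wl2 _ (esym (br_nat2 _ _ _)))) ?flatE.
rewrite -!br_nat (pre2 (esym (br_nat _ _ _))) ?flatE.
by rewrite (pre3 (br_del_r _ _ _)) ?flatE.
Qed.

Lemma transp_ev' W W' (g : Hom W' W) X :
  del (ev' W') X ∘ W' ◁ transp g X = del (ev' W) X ∘ g ▷ (W^⋆ ⊗ X).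
Proof.
rewrite !del_ev' ?flatE interchange (pre2 (transp_br _ _ _)) ?flatE.
rewrite (pre2 (transp_ev _ _)) ?flatE (pre2 (esym (br_nat1 _ _ _))) ?flatE.
by rewrite -!wr_comp twist_natural.
Qed.

(** At [coev] the morphism [g] becomes its transpose on the dual strand; there it belongs to the
    tail, passes [f], and [ev'] turns it back into [g]. *)
Lemma ptr_slide U U' W W' (f : Hom (U ⊗ W) (U' ⊗ W')) (g : Hom W' W) :
  ptr (U' ◁ g ∘ f) = ptr (f ∘ U ◁ g).
Proof.
apply: wr_inj => X; rewrite !ptr_wr !act2_comp !act2_wl ?flatE.
rewrite (wl2 _ (esym (transp_coev _ _))) ?flatE.
rewrite (pre2 (act2_nat _ _)) ?flatE.
by rewrite (pre2 (wl2 _ (transp_ev' _ _))) ?flatE.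
Qed.

(** The loop of [𝟙] has value one: this is [ptr_braid] at [𝟙], where crossing and twist are trivial.
    Adding a strand [U] on the left gives the claim for [U ⊗ 𝟙], and [runit] carries it to [U]. *)
Lemma ptr_id_unit U : ptr (idm (U ⊗ 𝟙)) = idm U.
Proof.
have e : ptr (idm ((U ⊗ 𝟙) ⊗ 𝟙)) = idm (U ⊗ 𝟙).
  rewrite -[RHS]tensor_id -twist_unit -ptr_braid -ptr_tail_wl braid_unit.
  by rewrite tensor_id ?flatE assocK.
transitivity (runit U ∘ (ptr (idm ((U ⊗ 𝟙) ⊗ 𝟙)) ∘ runit_inv U)).
  by rewrite -ptr_nat ?flatE -wr_comp runitVK tensor_id.
by rewrite e ?flatE runitVK.
Qed.

(** * Closing a strand [V ⊗ W] by closing [W] and then [V] *)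

(* The comparison [W^⋆ ⊗ V^⋆ -> (V ⊗ W)^⋆], acting on tails.  That it is
   invertible is never needed. *)
Definition dual_tensor V W X : Hom (W^⋆ ⊗ (V^⋆ ⊗ X)) ((V ⊗ W)^⋆ ⊗ X) :=
  locked (del (ev W) ((V ⊗ W)^⋆ ⊗ X)
    ∘ (W^⋆ ◁ del (ev V) (W ⊗ ((V ⊗ W)^⋆ ⊗ X))
    ∘ (W^⋆ ◁ V^⋆ ◁ assoc V W ((V ⊗ W)^⋆ ⊗ X)
    ∘ W^⋆ ◁ V^⋆ ◁ ins (coev (V ⊗ W)) X))).

Lemma dual_tensorE V W X :
  dual_tensor V W X = del (ev W) ((V ⊗ W)^⋆ ⊗ X)
    ∘ (W^⋆ ◁ del (ev V) (W ⊗ ((V ⊗ W)^⋆ ⊗ X))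
    ∘ (W^⋆ ◁ V^⋆ ◁ assoc V W ((V ⊗ W)^⋆ ⊗ X)
    ∘ W^⋆ ◁ V^⋆ ◁ ins (coev (V ⊗ W)) X)).
Proof. by rewrite /dual_tensor -lock. Qed.

Lemma dual_tensor_coev V W X :
  V ◁ W ◁ dual_tensor V W X ∘ (V ◁ ins (coev W) (V^⋆ ⊗ X) ∘ ins (coev V) X)
  = assoc V W ((V ⊗ W)^⋆ ⊗ X) ∘ ins (coev (V ⊗ W)) X.
Proof.
rewrite dual_tensorE ?flatE.
rewrite (pre2 (wl2 _ (esym (ins_nat (coev W) _)))) ?flatE.
rewrite (pre2 (wl2 _ (esym (ins_nat (coev W) _)))) ?flatE.
rewrite (pre2 (wl2 _ (esym (ins_nat (coev W) _)))) ?flatE.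
rewrite (pre2 (wl2 _ (zigzag_tail _ _))) ?flatE.
rewrite -(ins_nat (coev V)) (pre2 (esym (ins_nat (coev V) _))) ?flatE.
by rewrite (pre2 (zigzag_tail _ _)) ?flatE.
Qed.

Lemma dual_tensor_ev V W X :
  del (ev (V ⊗ W)) X ∘ dual_tensor V W ((V ⊗ W) ⊗ X)
  = del (ev W) X ∘ (W^⋆ ◁ del (ev V) (W ⊗ X) ∘ W^⋆ ◁ V^⋆ ◁ assoc V W X).
Proof.
rewrite dual_tensorE ?flatE (pre2 (esym (del_nat _ _))) ?flatE.
rewrite (pre2 (wl2 _ (esym (del_nat _ _)))) ?flatE.
rewrite (pre2 (wl2 _ (wl2 _ (esym (assoc_nat3 _ _ _))))) ?flatE.
by rewrite (wl2 _ (wl2 _ (zigzag_tail _ _))) ?flatE.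
Qed.

Lemma dual_tensor_br A V W X :
  br A ((V ⊗ W)^⋆) X ∘ A ◁ dual_tensor V W X
  = dual_tensor V W (A ⊗ X)
      ∘ (W^⋆ ◁ br A (V^⋆) X ∘ br A (W^⋆) (V^⋆ ⊗ X)).
Proof.
rewrite !dual_tensorE ?flatE -(br_ins_r A (coev (V ⊗ W))) ?flatE.
rewrite (pre2 (wl2 _ (wl2 _ (assoc_nat3 _ _ _)))) ?flatE.
rewrite (pre2 (wl2 _ (del_nat _ _))) ?flatE.
rewrite (pre2 (del_nat _ _)) ?flatE; congr (_ ∘ _).
rewrite (pre2 (wl2 _ (esym (br_nat _ _ _)))) ?flatE.
rewrite -br_nat ?flatE.
have e : assoc V W (A ⊗ ((V ⊗ W)^⋆ ⊗ X)) ∘ br A (V ⊗ W) ((V ⊗ W)^⋆ ⊗ X)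
   = V ◁ br A W ((V ⊗ W)^⋆ ⊗ X)
     ∘ (br A V (W ⊗ ((V ⊗ W)^⋆ ⊗ X)) ∘ A ◁ assoc V W ((V ⊗ W)^⋆ ⊗ X)).
  by rewrite (pre2 (br_tensor_r _ _ _ _)) ?flatE (wl2 _ (assocK _ _ _)) ?flatE.
rewrite (pre2 (wl2 _ (wl2 _ e))) ?flatE.
rewrite (pre2 (wl2 _ (del_nat _ _))) ?flatE.
rewrite (pre2 (wl2 _ (esym (br_nat _ _ _)))) ?flatE.
rewrite (pre2 (esym (br_nat _ _ _))) ?flatE.
rewrite (pre3 (wl3 _ (br_del_r _ _ _))) ?flatE.
rewrite (pre2 (esym (br_nat _ _ _))) ?flatE.
by rewrite (pre3 (br_del_r _ _ _)) ?flatE.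
Qed.

(** The double crossing inside [twist (V ⊗ W)] is what separates the two closures: after Yang-Baxter
    moves, [W] slides off the evaluation of [V], and [V] off that of [W]. *)
Lemma del_ev'_tensor V W X :
  del (ev' (V ⊗ W)) X ∘ (V ⊗ W) ◁ dual_tensor V W X
  = del (ev' V) X ∘ (V ◁ del (ev' W) (V^⋆ ⊗ X)
      ∘ assoc V W (W^⋆ ⊗ (V^⋆ ⊗ X))).
Proof.
have brA Z : V^⋆ ◁ assoc V W Z ∘ br (V ⊗ W) (V^⋆) Z
    = br V (V^⋆) (W ⊗ Z) ∘ (V ◁ br W (V^⋆) Z ∘ assoc V W (V^⋆ ⊗ Z)).
  by rewrite (pre2 (br_tensor_l _ _ _ _)) ?flatE assocK ?flatE.
have brB Z : W^⋆ ◁ assoc V W Z ∘ br (V ⊗ W) (W^⋆) Z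
    = br V (W^⋆) (W ⊗ Z) ∘ (V ◁ br W (W^⋆) Z ∘ assoc V W (W^⋆ ⊗ Z)).
  by rewrite (pre2 (br_tensor_l _ _ _ _)) ?flatE assocK ?flatE.
have twA Z : assoc V W Z ∘ twist (V ⊗ W) ▷ Z
    = br W V Z ∘ (br V W Z ∘ (twist V ▷ (W ⊗ Z) ∘ (V ◁ (twist W ▷ Z)
        ∘ assoc V W Z))).
  have -> : twist V ▷ (W ⊗ Z) ∘ (V ◁ (twist W ▷ Z) ∘ assoc V W Z)
      = assoc V W Z ∘ (twist V ⊠ twist W) ▷ Z.
    by rewrite assoc_natural comp_assoc -tensor_comp ?flatE.
  rewrite twist_tensor !wr_comp ?flatE /br !act2E ?flatE.
  by rewrite (pre2 (assocK _ _ _)) ?flatE (pre2 (assocK _ _ _)) ?flatE.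
rewrite !del_ev' ?flatE interchange (pre2 (dual_tensor_br _ _ _ _)) ?flatE.
rewrite (pre2 (dual_tensor_ev _ _ _)) ?flatE.
rewrite (pre2 (wl2 _ (brA _))) ?flatE (pre2 (brB _)) ?flatE twA.
rewrite (pre3 (yang_baxter _ _ _ _)) ?flatE.
rewrite (pre3 (wl3 _ (yang_baxter _ _ _ _))) ?flatE.
rewrite (pre3 (wl3 _ (br_del_r _ _ _))) ?flatE (pre2 (del_nat _ _)) ?flatE.
rewrite (pre2 (del_nat _ _)) ?flatE.
rewrite (pre3 (yang_baxter _ _ _ _)) ?flatE (pre3 (br_del_r _ _ _)) ?flatE.
by do 5 rewrite ?(pre2 (interchange _ _)) ?flatE.
Qed.

(** By [coevA] the coevaluation of [V ⊗ W] is the two nested ones followed by [dual_tensor], which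
    passes [f] in the tail and is absorbed by [ev']. *)
Lemma ptr_tensor U U' V W (f : Hom (U ⊗ (V ⊗ W)) (U' ⊗ (V ⊗ W))) :
  ptr f = ptr (ptr (assoc_inv U' V W ∘ (f ∘ assoc U V W))).
Proof.
have coevA X : ins (coev (V ⊗ W)) X = (V ⊗ W) ◁ dual_tensor V W X
    ∘ (assoc_inv V W (W^⋆ ⊗ (V^⋆ ⊗ X))
    ∘ (V ◁ ins (coev W) (V^⋆ ⊗ X) ∘ ins (coev V) X)).
  rewrite (pre2 (esym (assocV_nat3 _ _ _))) ?flatE dual_tensor_coev.
  by rewrite (pre2 (assocK _ _ _)) ?flatE.
apply: wr_inj => X; rewrite !ptr_wr coevA ?flatE.
rewrite (pre2 (act2_nat _ _)) ?flatE (pre2 (wl2 _ (del_ev'_tensor _ _ _))) ?flatE.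
congr (_ ∘ _); rewrite [act2 (ptr _) _]act2E ptr_wr ?flatE.
rewrite (pre2 (assoc_nat3 _ _ _)) ?flatE (pre2 (esym (assocV_nat3 _ _ _))) ?flatE.
by rewrite (pre3 (act2_conj_assoc _ _)) ?flatE.
Qed.

(** * The interlaced endomorphism of [J ⊗ J] and its two closures *)

(** The version of [br_act2_l] in which the moving strand [A] ends up past everything, with no tail
    behind [P ⊗ Q]. *)
Lemma braid_past P Q P' Q' A (f : Hom (P ⊗ Q) (P' ⊗ Q')) :
  A ◁ f ∘ (br P A Q ∘ P ◁ braid Q A)
  = br P' A Q' ∘ (P' ◁ braid Q' A ∘ act2 f A).
Proof.
have hex R S : br R A S ∘ R ◁ braid S A = braid (R ⊗ S) A ∘ assoc_inv R S A.
  have h := hexagon2 R S A; rewrite ?flatE in h.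
  by rewrite /br act2E ?flatE -h (pre2 (assocVK _ _ _)) ?flatE.
rewrite hex (pre2 (hex _ _)) ?flatE act2E (pre2 (assocK _ _ _)) ?flatE.
by rewrite (pre2 (esym (braid_natural _ _))) ?flatE.
Qed.

Section Core.
Variables (J W W' : C).
Variables (F : Hom (J ⊗ W) (J ⊗ W')) (G : Hom (J ⊗ W') (J ⊗ W)).

(** [F] acts on [W] and the nearer strand [J], the two strands [J] cross, then [G] acts on [W'] and
    the other one. Here [K] does not denote the ground ring. *)
Let K : Hom (J ⊗ (J ⊗ W)) (J ⊗ (J ⊗ W)) := J ◁ G ∘ (br J J W' ∘ J ◁ F).

(** With [J ⊗ W] closed as one strand, [G] slides around the loop to meet [F]. The crossing then
    carries only [ptr (F ∘ G)], and closing it produces the twist. *)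
Lemma ptr_interlace :
  ptr (ptr (assoc_inv J J W ∘ (K ∘ assoc J J W))) = ptr (F ∘ (G ∘ twist J ▷ W')).
Proof.
rewrite -ptr_tensor ptr_slide ?flatE ptr_tensor.
have -> : assoc_inv J J W' ∘
      ((br J J W' ∘ (J ◁ F ∘ J ◁ G)) ∘ assoc J J W')
    = braid J J ▷ W' ∘ ((assoc_inv J J W' ∘ (J ◁ (F ∘ G) ∘ assoc J J W'))
        ∘ (idm _) ▷ W').
  by rewrite /br act2E ?flatE (pre2 (assocK _ _ _)) ?flatE.
rewrite ptr_nat ptr_tail_wl ?flatE braid_natural.
have -> : ptr (F ∘ G) ▷ J ∘ braid J J
    = ptr (F ∘ G) ▷ J ∘ (braid J J ∘ (idm J) ▷ J) by rewrite ?flatE.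
rewrite ptr_nat ptr_braid -[F ∘ (_ ∘ _)]comp_idl -tensor_id.
by rewrite (comp_assoc F) ptr_nat ?flatE.
Qed.

(** Conjugation by the crossing exchanges the strands [J], so the other one gets closed. Carrying
    [F] and [G] to the open strand leaves a closed [J] that contributes only a kink between them. *)
Lemma ptr_interlace_conj ci : inverse_pair (braid J J) ci ->
  ptr (ci ∘ (ptr (assoc_inv J J W ∘ (K ∘ assoc J J W)) ∘ braid J J))
  = ptr (G ∘ (twist J ▷ W' ∘ F)).
Proof.
move=> [ciK Kci].
have [si [siK Ksi]] := braid_iso W' J.
(* [Z] is the crossing of the strands [J] with the one to be closed moved beyond [W']. *)
pose Z := assoc_inv J W' J ∘
  ((J ◁ si ∘ (br J J W' ∘ J ◁ braid W' J)) ∘ assoc J W' J).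
have ptrZ : ptr Z = twist J ▷ W'.
  (* A Yang-Baxter move brings the crossing to the other side of [W'], so that [Z] is a conjugate of
     [W' ◁ braid J J] and [ptr_braid] applies. *)
  have YB : br J J W' ∘ J ◁ braid W' J
      = J ◁ braid W' J ∘
        (act2 (braid W' J) J ∘ (W' ◁ braid J J ∘ act2 si J)).
    rewrite -/(br W' J J) (pre3 (braid_past _ _)) ?flatE -act2_comp Ksi.
    by rewrite act2_id ?flatE.
  have -> : Z = braid W' J ▷ J ∘
      ((assoc_inv W' J J ∘ (W' ◁ braid J J ∘ assoc W' J J)) ∘ si ▷ J).
    rewrite /Z YB ?flatE (pre2 (wl2 _ siK)) ?flatE !act2E ?flatE.
    by rewrite (pre2 (assocK _ _ _)) ?flatE assocK ?flatE.
  rewrite ptr_nat ptr_tail_wl ptr_braid (pre2 (braid_natural _ _)) ?flatE.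
  by rewrite Ksi ?flatE.
have [s [sK Ks]] := braid_iso W J.
(* [braid_past] moves [G] to the first strand [J]; the crossing this releases cancels [ci]. *)
have -> : ci ∘ (ptr (assoc_inv J J W ∘ (K ∘ assoc J J W)) ∘ braid J J)
    = ptr (assoc_inv J J W ∘ ((J ◁ braid W J ∘ (act2 G J ∘ (J ◁ si ∘
        (J ◁ F ∘ br J J W)))) ∘ assoc J J W)).
  have brK : assoc_inv J J W ∘ br J J W = braid J J ▷ W ∘ assoc_inv J J W.
    by rewrite /br act2E (pre2 (assocK _ _ _)) ?flatE.
  rewrite -ptr_nat; congr ptr; rewrite ?flatE.
  have GE : J ◁ G ∘ br J J W'
      = br J J W ∘ (J ◁ braid W J ∘ (act2 G J ∘ J ◁ si)).
    by rewrite (pre3 (esym (braid_past _ _))) ?flatE (wl2 _ Ksi) ?flatE.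
  rewrite /K ?flatE (pre2 GE) ?flatE (pre2 brK) ?flatE.
  rewrite (pre2 (wr2 _ ciK)) ?flatE /br !act2E ?flatE.
  by rewrite assocK ?flatE.
(* Sliding [J ◁ braid W J] around the loop changes the closed strand from [J ⊗ W] to [W ⊗ J]. Now
   [braid_past] can move [F] to the first [J], and the closed [J] comes last. *)
rewrite -ptr_tensor ptr_slide ?flatE braid_past ptr_tensor.
have -> : assoc_inv J W J ∘ ((act2 G J ∘ (J ◁ si ∘ (br J J W' ∘
      (J ◁ braid W' J ∘ act2 F J)))) ∘ assoc J W J)
    = G ▷ J ∘ (Z ∘ F ▷ J).
  by rewrite !act2E ?flatE (pre2 (assocK _ _ _)) ?flatE assocK ?flatE /Z ?flatE.
by rewrite ptr_nat ptrZ.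
Qed.
End Core.

(* The twist picked up from the kink is compensated in advance in [G]. *)
Lemma ambidextrous_ptr_cyclic J W W' (t : functional J)
    (F : Hom (J ⊗ W) (J ⊗ W')) (G : Hom (J ⊗ W') (J ⊗ W)) :
  ambidextrous t -> t (ptr (G ∘ F)) = t (ptr (F ∘ G)).
Proof.
move=> [_ t_ambi].
have [ti [tiK Kti]] := twist_iso J; have [ci [ciK Kci]] := braid_iso J J.
pose h' := ptr (assoc_inv J J W ∘
  ((J ◁ (G ∘ ti ▷ W') ∘ (br J J W' ∘ J ◁ F)) ∘ assoc J J W)).
pose h : endo (J ⊗ J) := (ci ∘ (h' ∘ braid J J) : Hom (J ⊗ J) (J ⊗ J)).
have trLh : trL h = ptr h'.
  by rewrite (@ptr_conj_braid J J h h') // /h (pre2 Kci) ?flatE.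
have := t_ambi h; rewrite trLh trRE /h /h' ptr_interlace.
rewrite ptr_interlace_conj // ?flatE.
by rewrite (wr2 _ tiK) (pre2 (wr2 _ tiK)) ?flatE => ->.
Qed.

(** * Linearity over the ground ring *)

(** The scalar as a natural endomorphism of every object: the module action is composition with it,
    so linearity follows from additivity and naturality. *)
Definition scal (k : ground C) V : Hom V V :=
  locked (lunit V ∘ ((k : Hom 𝟙 𝟙) ▷ V ∘ lunit_inv V)).

Lemma scalE (k : ground C) V :
  scal k V = lunit V ∘ ((k : Hom 𝟙 𝟙) ▷ V ∘ lunit_inv V).
Proof. by rewrite /scal -lock. Qed.

Lemma scaleE (k : ground C) V (f : endo V) :
  (k *: f : endo V) = (f : Hom V V) ∘ scal k V :> Hom V V.
Proof.
change (lunit V ∘ tensor_hom (k : Hom 𝟙 𝟙) (f : Hom V V) ∘ lunit_inv V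
  = (f : Hom V V) ∘ scal k V).
rewrite !scalE (comp_assoc (f : Hom V V)) -lunit_natural -!comp_assoc.
by rewrite (comp_assoc (𝟙 ◁ _)) -tensor_comp ?flatE.
Qed.

Lemma scal_nat (k : ground C) V W (f : Hom V W) : scal k W ∘ f = f ∘ scal k V.
Proof.
rewrite !scalE ?flatE lunitV_nat (pre2 (interchange _ _)) ?flatE.
by rewrite (pre2 (lunit_natural _)) ?flatE.
Qed.

Lemma scal_tensor (k : ground C) V W : scal k (V ⊗ W) = scal k V ▷ W.
Proof.
rewrite !scalE !wr_comp -lunit_tensor -lunitV_tensor ?flatE.
by rewrite (pre2 (assoc_nat1 _ _ _)) ?flatE (pre2 (assocVK _ _ _)) ?flatE.
Qed.

Lemma trR_linear U W : linear (@trR C U W).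
Proof.
move=> k f g; rewrite !trRE scaleE.
change (ptr ((f : Hom (U ⊗ W) (U ⊗ W)) ∘ scal k (U ⊗ W) + g)
  = (k *: (ptr (f : Hom (U ⊗ W) (U ⊗ W)) : endo U) : endo U)
    + ptr (g : Hom (U ⊗ W) (U ⊗ W))).
rewrite ptr_add scal_tensor scaleE; congr (_ + _).
by have := ptr_nat (idm U) (f : Hom (U ⊗ W) (U ⊗ W)) (scal k U); rewrite ?flatE.
Qed.

Lemma compress_linear U V (α : Hom U V) (β : Hom V U) :
  linear (fun f : endo U => (α ∘ ((f : Hom U U) ∘ β) : Hom V V) : endo V).
Proof.
move=> k f g; rewrite scaleE.
change (α ∘ (((f : Hom U U) ∘ scal k U + g) ∘ β)
  = (k *: ((α ∘ ((f : Hom U U) ∘ β) : Hom V V) : endo V) : endo V)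
    + α ∘ ((g : Hom U U) ∘ β)).
by rewrite compDl compDr scaleE ?flatE scal_nat.
Qed.

(** * Traces on ideals are ambidextrous *)

Section TraceOnIdeal.
Variables (I : ideal C) (t : trace_family I).
Hypothesis tP : is_trace I t.

Lemma trace_ambidextrous V (IV : I V) : ambidextrous (t IV).
Proof.
have [lin partial cyc] := tP; split=> [|f]; first exact: lin.
have [ci [ciK Kci]] := braid_iso V V.
pose h : Hom (V ⊗ V) (V ⊗ V) := braid V V ∘ ((f : Hom (V ⊗ V) (V ⊗ V)) ∘ ci).
have <- : ptr h = trL f.
  by apply: ptr_conj_braid; rewrite /h ?flatE ciK ?flatE.
(* The partial trace property lifts both sides to [V ⊗ V], where cyclicity removes the
   conjugation. *)
rewrite -(trRE (h : endo (V ⊗ V))) -!partial /h.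
by rewrite (cyc _ _ (ideal_tensor V IV) (ideal_tensor V IV)) ?flatE ciK ?flatE.
Qed.

End TraceOnIdeal.

(** * Extending an ambidextrous trace from [J] to its ideal *)

Section Extension.
Variables (J : C) (tJ : functional J).
Hypothesis tJ_ambi : ambidextrous tJ.

Lemma retract_indep U W W' (α : Hom U (J ⊗ W)) (β : Hom (J ⊗ W) U)
    (α' : Hom U (J ⊗ W')) (β' : Hom (J ⊗ W') U) (f : Hom U U) :
  β ∘ α = idm U -> β' ∘ α' = idm U ->
  tJ (ptr (α ∘ (f ∘ β))) = tJ (ptr (α' ∘ (f ∘ β'))).
Proof.
move=> βα βα'.
(* Inserting [β' ∘ α' = idm U] splits the compression into a map to [J ⊗ W'] and one back, which can
   be interchanged under [tJ]. *)
have -> : α ∘ (f ∘ β) = (α ∘ (f ∘ β')) ∘ (α' ∘ β).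
  by rewrite ?flatE (pre2 βα') ?flatE.
rewrite ambidextrous_ptr_cyclic //; congr (tJ (ptr _)).
by rewrite ?flatE (pre2 βα) ?flatE.
Qed.

Lemma extension_ex U (IU : ideal_of J U) (f : endo U) :
  exists k, exists W (α : Hom U (J ⊗ W)) (β : Hom (J ⊗ W) U),
    β ∘ α = idm U /\ k = tJ (ptr (α ∘ ((f : Hom U U) ∘ β))).
Proof.
have [W [α [β βα]]] := IU.
by exists (tJ (ptr (α ∘ ((f : Hom U U) ∘ β)))), W, α, β.
Qed.

(** Membership in the ideal only asserts that a retract exists, so a value is chosen by [cid];
    [retract_indep] makes the choice immaterial. *)
Definition extension : trace_family (ideal_of J) :=
  fun U IU f => sval (cid (extension_ex IU f)).

Lemma extensionE U (IU : ideal_of J U) (f : endo U) W (α : Hom U (J ⊗ W))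
    (β : Hom (J ⊗ W) U) :
  β ∘ α = idm U ->
  extension IU f = tJ (ptr (α ∘ ((f : Hom U U) ∘ β))).
Proof.
move=> βα; rewrite /extension; case: cid => k /= [W' [α' [β' [βα' ->]]]].
exact: retract_indep.
Qed.

(** Computed with [J] as a retract of [J ⊗ 𝟙]: [f] leaves the partial trace by naturality, and the
    loop of [𝟙] has value one. *)
Lemma extension_self : extension (ideal_of_self J) = tJ.
Proof.
apply/funext => f; have rK := runitVK J; rewrite (extensionE _ _ rK).
have -> : runit_inv J ∘ ((f : Hom J J) ∘ runit J)
    = (f : Hom J J) ▷ 𝟙 ∘ (idm (J ⊗ 𝟙) ∘ (idm J) ▷ 𝟙).
  by rewrite -runit_natural (pre2 (runitK J)) ?flatE.
by rewrite ptr_nat ptr_id_unit ?flatE.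
Qed.

Lemma extension_is_trace : is_trace (ideal_of J) extension.
Proof.
split.
- move=> V IV k f g; have [W [α [β βα]]] := IV.
  rewrite !(extensionE _ _ βα).
  have [lin _] := tJ_ambi.
  have := compress_linear α β k f g; cbv beta => ->.
  have := @trR_linear J W k (α ∘ ((f : Hom V V) ∘ β) : Hom _ _)
    (α ∘ ((g : Hom V V) ∘ β) : Hom _ _).
  by rewrite !trRE => ->; rewrite lin.
- move=> U W IU f; have [X [α [β βα]]] := IU.
  (* [U ⊗ W] is a retract of [J ⊗ (X ⊗ W)], and closing [X ⊗ W] is closing [W] and then [X]. *)
  have βαW : (β ▷ W ∘ assoc_inv J X W) ∘ (assoc J X W ∘ α ▷ W) = idm _.
    by rewrite ?flatE (pre2 (assocK _ _ _)) ?flatE (wr2 _ βα) ?flatE.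
  rewrite (extensionE _ _ βα) (extensionE _ _ βαW) trRE -ptr_nat ptr_tensor.
  congr (tJ (ptr (ptr _))).
  by rewrite ?flatE (pre2 (assocK _ _ _)) ?flatE assocK ?flatE.
- move=> U V IU IV f g; have [X [α [β βα]]] := IU; have [Y [γ [δ δγ]]] := IV.
  rewrite (extensionE _ _ βα) (extensionE _ _ δγ).
  have -> : γ ∘ ((g ∘ f) ∘ δ) = (γ ∘ (g ∘ β)) ∘ (α ∘ (f ∘ δ)).
    by rewrite ?flatE (pre2 βα) ?flatE.
  rewrite ambidextrous_ptr_cyclic //; congr (tJ (ptr _)).
  by rewrite ?flatE (pre2 δγ) ?flatE.
Qed.

(** Cyclicity replaces [f] by its compression to [J ⊗ W], and the partial trace property brings that
    down to [J]; hence the values on [J] determine the trace. *)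
Lemma extension_unique (t : trace_family (ideal_of J)) :
  is_trace (ideal_of J) t -> t J (ideal_of_self J) = tJ -> extension = t.
Proof.
move=> tP tself; apply: functional_extensionality_dep => U.
apply: functional_extensionality_dep => IU; apply/funext => f.
have [W [α [β βα]]] := IU; rewrite (extensionE _ _ βα) -tself.
have [_ partial cyc] := tP.
rewrite -(trRE (α ∘ ((f : Hom U U) ∘ β) : endo (J ⊗ W))) -partial.
by rewrite (cyc U (J ⊗ W) IU) ?flatE βα ?flatE.
Qed.
End Extension.

End Ribbon.

Theorem theorem1p3p1 (C : ribbon_category) (Kfield : is_field (ground C)) :
  (forall (I : ideal C) (t : trace_family I), is_trace I t ->
     forall (V : C) (IV : I V), ambidextrous (t V IV))
  /\
  (forall (J : C) (tJ : functional J), ambidextrous tJ ->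
     exists! t : trace_family (ideal_of J),
       is_trace (ideal_of J) t /\ t J (ideal_of_self J) = tJ).
Proof.
split=> [I t tP V IV|J tJ tJ_ambi]; first exact: trace_ambidextrous.
exists (extension tJ); split.
  by split; [exact: extension_is_trace | exact: extension_self].
move=> t [tP tself]; exact: extension_unique.
Qed.
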